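(* If $G\cong M_{22}$ (the Mathieu simple group of degree 22), then $\pi(G)=\pi(V(\mathbb{Z}G))$.
   Context: For a finite group $G$, $V(\mathbb{Z}G)$ denotes the normalized unit group of the integral group ring $\mathbb{Z}G$, i.e. the group of units $\sum_{g\in G}\alpha_g g$ of $\mathbb{Z}G$ with $\sum_{g\in G}\alpha_g=1$. For a finite group $G$, the Gruenberg–Kegel graph (prime graph) $\pi(G)$ is the graph whose vertices are the primes dividing $|G|$ (equivalently, the primes $p$ such that $G$ has an element of order $p$), with an edge joining distinct primes $p$ and $q$ if there is an element of order $pq$ in $G$. For the group $V(\mathbb{Z}G)$, the graph $\pi(V(\mathbb{Z}G))$ is defined likewise: its vertices are the primes $p$ such that $V(\mathbb{Z}G)$ contains an element of order $p$, and distinct vertices $p,q$ are joined by an edge if and only if $V(\mathbb{Z}G)$ contains an element of order $pq$. Equality of graphs means equality of the vertex sets and of the edge sets. *)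

(* Defs.v *)
From HB Require Import structures.
From mathcomp Require Import all_boot all_order all_algebra all_fingroup.

Set Implicit Arguments.
Unset Strict Implicit.
Unset Printing Implicit Defensive.

Import GRing.Theory.
Local Open Scope ring_scope.

(* The library's ring structure on {ffun gT -> R} is the pointwise one, so the *)
(* group ring is an alias carrying only the additive structure of {ffun _}.    *)
Definition group_ring (R : nzRingType) (gT : finGroupType) : Type :=
  {ffun gT -> R}.

HB.instance Definition _ (R : nzRingType) (gT : finGroupType) :=
  GRing.Zmodule.copy (group_ring R gT) {ffun gT -> R}.

Section GroupRing.
Variables (R : nzRingType) (gT : finGroupType).
Implicit Types x y z : group_ring R gT.

Definition coeff x (g : gT) : R := (x : {ffun gT -> R}) g.

Definition group_ring_one : group_ring R gT :=
  [ffun g : gT => (g == 1%g)%:R : R].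

Definition group_ring_mul x y : group_ring R gT :=
  [ffun g : gT => \sum_(h : gT) coeff x h * coeff y (h^-1 * g)%g].

Fact group_ring_mulA : associative group_ring_mul.
Proof.
move=> x y z; apply/ffunP => g; rewrite !ffunE /coeff.
under eq_bigr => h _ do rewrite ffunE mulr_sumr.
under [RHS]eq_bigr => h _ do rewrite ffunE mulr_suml.
rewrite [RHS]exchange_big /=; apply: eq_bigr => h _.
rewrite (reindex_inj (mulgI (h^-1)%g)) /=; apply: eq_bigr => k _.
by rewrite invMg invgK -mulgA mulKVg mulrA.
Qed.

Fact group_ring_mul1l : left_id group_ring_one group_ring_mul.
Proof.
move=> x; apply/ffunP => g; rewrite ffunE (bigD1 1%g) //= big1 ?addr0.
  by rewrite /coeff ffunE eqxx mul1r invg1 mul1g.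
by move=> h /negPf nh; rewrite /coeff ffunE nh mul0r.
Qed.

Fact group_ring_mul1r : right_id group_ring_one group_ring_mul.
Proof.
move=> x; apply/ffunP => g; rewrite ffunE (bigD1 g) //= big1 ?addr0.
  by rewrite /coeff ffunE mulVg eqxx mulr1.
by move=> h nh; rewrite /coeff ffunE -eq_mulVg1 (negPf nh) mulr0.
Qed.

Fact group_ring_mulDl : left_distributive group_ring_mul +%R.
Proof.
move=> x y z; apply/ffunP => g; rewrite !ffunE -big_split /=.
by apply: eq_bigr => h _; rewrite /coeff ffunE mulrDl.
Qed.

Fact group_ring_mulDr : right_distributive group_ring_mul +%R.
Proof.
move=> x y z; apply/ffunP => g; rewrite !ffunE -big_split /=.
by apply: eq_bigr => h _; rewrite /coeff ffunE mulrDr.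
Qed.

Fact group_ring_one_neq0 : group_ring_one != 0.
Proof.
apply/eqP => /ffunP/(_ 1%g); rewrite !ffunE eqxx => /eqP.
by rewrite oner_eq0.
Qed.

HB.instance Definition _ := GRing.Zmodule_isNzRing.Build (group_ring R gT)
  group_ring_mulA group_ring_mul1l group_ring_mul1r
  group_ring_mulDl group_ring_mulDr group_ring_one_neq0.

Definition augmentation x : R := \sum_(g : gT) coeff x g.

Definition is_unit x : Prop := exists y, x * y = 1 /\ y * x = 1.

End GroupRing.

(* The group V(ZG), as a predicate on ZG.                                      *)
Definition normalized_unit (gT : finGroupType) (u : group_ring int gT) : Prop :=
  is_unit u /\ augmentation u = 1.

Definition has_order (A : nzRingType) (u : A) (n : nat) : Prop :=
  [/\ (0 < n)%N, u ^+ n = 1 & forall m, (0 < m < n)%N -> u ^+ m <> 1].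

Record graph := Graph { vertex : nat -> Prop; edge : nat -> nat -> Prop }.

Definition eq_graph (X Y : graph) : Prop :=
  (forall p, vertex X p <-> vertex Y p) /\
  (forall p q, edge X p q <-> edge Y p q).

Definition prime_graph (gT : finGroupType) : graph :=
  let V p := prime p /\ (p %| #|gT|)%N in
  Graph V (fun p q => [/\ V p, V q, p <> q & exists g : gT, #[g]%g = (p * q)%N]).

Definition prime_graph_V (gT : finGroupType) : graph :=
  let has_elt n := exists u : group_ring int gT, normalized_unit u /\ has_order u n in
  let V p := prime p /\ has_elt p in
  Graph V (fun p q => [/\ V p, V q, p <> q & has_elt (p * q)%N]).

(* The cycle (c_1 c_2 ... c_k); undup only serves to make it total, it is the  *)
(* identity on the duplicate-free sequences used below.                        *)
Definition cycle_perm (T : finType) (c : seq T) : {perm T} :=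
  perm (can_inj (prev_next (undup_uniq c))).

(* Products of disjoint cycles on the 22 points 1, ..., 22, the point k being  *)
(* represented by the ordinal k - 1.                                           *)
Definition perm22 (cs : seq (seq nat)) : {perm 'I_22} :=
  (\prod_(c <- cs) cycle_perm [seq inord k.-1 : 'I_22 | k <- c])%g.

Definition M22_gen1 := perm22
  [:: [:: 1; 2; 3; 4; 5; 6; 7; 8; 9; 10; 11];
      [:: 12; 13; 14; 15; 16; 17; 18; 19; 20; 21; 22]]%N.

Definition M22_gen2 := perm22
  [:: [:: 1; 4; 5; 9; 3]; [:: 2; 8; 10; 7; 6];
      [:: 12; 15; 16; 20; 14]; [:: 13; 19; 21; 18; 17]]%N.

Definition M22_gen3 := perm22
  [:: [:: 1; 21]; [:: 2; 10; 8; 6]; [:: 3; 13; 4; 17];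
      [:: 5; 19; 9; 18]; [:: 11; 22]; [:: 12; 14; 16; 20]]%N.

(* The Mathieu group of degree 22 in its natural permutation representation,   *)
(* on the generators of MathieuGroup(22) in GAP; it is simple, of order 443520. *)
Definition M22 : {group {perm 'I_22}} :=
  <<[set M22_gen1; M22_gen2; M22_gen3]>>%G.

(* Main.v *)
Require Import Defs.
From mathcomp Require Import all_boot all_order all_algebra all_fingroup.
From mathcomp Require Import all_solvable all_field.
From mathcomp Require Import ring zify.

(* Let u be a normalized torsion unit of ZG. The class sum of u at x, the sum  *)
(* of the coefficients of u over the conjugates of x (with multiplicity), is   *)
(* the trace of m |-> u m x^-1 on ZG. It vanishes unless the order of x is a   *)
(* nontrivial divisor of the order of u (Berman-Higman, and special cases of a *)
(* theorem of Hertweck). For x <> 1 the vanishing is obtained p-adically: that *)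
(* operator is a product s t of commuting factors with s of r-power order, and *)
(* some a satisfies sum_(i < r^(k+1)) s^i a s^-i = 1 mod r. Expanding powers   *)
(* of this sum into words, a rotation of words twisted by s preserves traces   *)
(* and has only orbits of maximal length, so that high powers of r divide      *)
(* tr (s t^(r^j)), which is tr (s t) for infinitely many j.                    *)
(* If G has no element of order p q, the traces of a unit of order p q on the  *)
(* permutation modules of M22 on 22 points and on 77 hexads depend therefore   *)
(* on a single unknown integer, and the multiplicities of its eigenvalues      *)
(* cannot all be nonnegative integers (Luthar-Passi method). The permutation   *)
(* characters on elements of prime order are read off from explicit Sylow      *)
(* subgroups, given the order of M22; the latter is bounded above by a         *)
(* stabilizer chain using that M22 preserves 77 hexads and 176 heptads.        *)

Set Implicit Arguments.
Unset Strict Implicit.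
Unset Printing Implicit Defensive.

(** * The generators, hexads and heptads of M22 *)

(** An element of G is itself a normalized unit of the same order, so the graph of G is contained in
    that of V(ZG). Conversely, let u be a unit of prime order p. Its class sums add up to |G|, and
    they can be nonzero only at elements of order p, so p divides |G| ([prime_order_unit_dvdn]).

    For the edges, let u have order p q and suppose that G has no element of that order. Since G has
    elements of order 6, p q is not 6, and nine pairs of primes are left to refute. The class sums
    of u vanish off the elements of order p or q ([class_sum_support]). Let c be the sum of the
    coefficients of u at elements of order p. A permutation character with values fp and fq on
    elements of order p and q then takes the value t = c fp + (1 - c) fq at u, and fp, fq at u^q,
    u^p. Fourier inversion turns these traces into eigenvalue multiplicities
    ([unit_pq_multiplicities]). For the action on points or on hexads, no integer c makes all of
    them nonnegative integers ([no_unit_order]).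

    The vanishing rests on [trace_twisted_eq0]. It is applied with a colouring of G when a prime
    divides the order of x but not that of u ([class_sum_eq0]), and with a quarter turn when 4
    divides the order of x and u has order dividing twice an odd number ([class_sum4_eq0]). The
    fixed point counts come from explicit subgroups of prime power order. These are Sylow subgroups
    because their orders bound |M22| from below while [leq_card_M22] bounds it from above. *)

Definition code (s : {perm 'I_22}) : seq nat := [seq val (s i) | i <- enum 'I_22].

(** Permutations are computed with through their image lists; as for the product of permutations,
    the left factor acts first. *)
Definition lmul (a b : seq nat) : seq nat := [seq nth 0 b i | i <- a].

Lemma nth_code s (i : 'I_22) : nth 0 (code s) i = s i.
Proof. by rewrite (nth_map i) ?size_enum_ord // nth_ord_enum. Qed.

Lemma nth_code_nat s i (lt_i : i < 22) : nth 0 (code s) i = s (Ordinal lt_i).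
Proof. exact: (nth_code s (Ordinal lt_i)). Qed.

Lemma code_inj : injective code.
Proof.
move=> s t st; apply/permP => i; apply/val_inj.
by rewrite /= -!nth_code st.
Qed.

Lemma codeM s t : code (s * t)%g = lmul (code s) (code t).
Proof.
by rewrite /lmul -map_comp; apply: eq_map => i; rewrite /= permM nth_code.
Qed.

Lemma code1 : code 1%g = iota 0 22.
Proof. by rewrite -val_enum_ord; apply: eq_map => i; rewrite perm1. Qed.

Lemma code_cycle (c : seq nat) : uniq c -> all (fun k => 0 < k <= 22) c ->
  code (cycle_perm [seq inord k.-1 : 'I_22 | k <- c])
    = [seq next [seq k.-1 | k <- c] i | i <- iota 0 22].
Proof.
move=> uniq_c /allP lt_c; set s := map _ _.
have Es : map val s = [seq k.-1 | k <- c].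
  rewrite -map_comp; apply/eq_in_map => k /lt_c /andP[k_gt0 k_le].
  by rewrite /= inordK // prednK.
have uniq_s : uniq s.
  rewrite -(map_inj_uniq val_inj) Es map_inj_in_uniq // => i j.
  by move=> /lt_c/andP[i0 _] /lt_c/andP[j0 _] /(congr1 S); rewrite !prednK.
rewrite -val_enum_ord -map_comp; apply: eq_map => i /=.
by rewrite permE undup_id // -Es (next_map val_inj).
Qed.

Definition gens : seq {perm 'I_22} := [:: M22_gen1; M22_gen2; M22_gen3].

Definition gen_lists : seq (seq nat) :=
  [:: [:: 1; 2; 3; 4; 5; 6; 7; 8; 9; 10; 0; 12; 13; 14; 15; 16; 17; 18; 19; 20; 21; 11];
      [:: 3; 7; 0; 4; 8; 1; 5; 9; 2; 6; 10; 14; 18; 11; 15; 19; 12; 16; 20; 13; 17; 21];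
      [:: 20; 9; 12; 16; 18; 1; 6; 5; 17; 7; 21; 13; 3; 15; 14; 19; 2; 4; 8; 11; 0; 10]].

Definition cycles_list (cs : seq (seq nat)) : seq nat :=
  foldr (fun c => lmul [seq next [seq k.-1 | k <- c] i | i <- iota 0 22])
    (iota 0 22) cs.

Lemma code_perm22 cs : all uniq cs -> all (all (fun k => 0 < k <= 22)) cs ->
  code (perm22 cs) = cycles_list cs.
Proof.
rewrite /perm22; elim: cs => [|c cs IH] /=; first by rewrite big_nil code1.
move=> /andP[uc ucs] /andP[lc lcs]; rewrite big_cons codeM IH //.
by rewrite code_cycle.
Qed.


Lemma code_gens : map code gens = gen_lists.
Proof. by rewrite /= /M22_gen1 /M22_gen2 /M22_gen3 !code_perm22. Qed.

Lemma mem_gens s : s \in gens -> s \in M22.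
Proof.
move=> sg; apply: mem_gen; move: sg; rewrite !inE.
by case/or3P => ->; rewrite ?orbT.
Qed.

Lemma M22_ind (P : {set {perm 'I_22}}) :
  group_set P -> (forall l, l \in gen_lists -> exists2 s, code s = l & s \in P) ->
  M22 \subset P.
Proof.
move=> gP genP; rewrite -[P]/(gval (Group gP)) gen_subG.
apply/subsetP => s sg; have : code s \in gen_lists.
  rewrite -code_gens map_f //; move: sg; rewrite !inE -orbA.
  by [].
by case/genP => t /code_inj ->.
Qed.

Definition block_img (l B : seq nat) : seq nat :=
  [seq x <- iota 0 22 | x \in [seq nth 0 l y | y <- B]].

Definition block_orbit n (B : seq nat) : seq (seq nat) :=
  iter n (fun S => undup (S ++ [seq block_img l C | l <- gen_lists, C <- S])) [:: B].

(** The blocks of the Steiner system S(3,6,22). That eight rounds exhaust the orbit is confirmed by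
    [blocks_inv]. *)
Definition hexads : seq (seq nat) :=
  Eval vm_compute in block_orbit 8 [:: 0; 1; 2; 6; 9; 19].

(* One of the two M22-orbits of such 7-sets. The outer automorphism of M22     *)
(* preserves the hexads but exchanges these orbits, so that the hexads alone   *)
(* would not bound the order of M22.                                           *)
Definition heptads : seq (seq nat) :=
  Eval vm_compute in block_orbit 10 [:: 0; 1; 2; 3; 5; 12; 15].


Lemma mem_points x : (x \in iota 0 22) = (x < 22).
Proof. by rewrite mem_iota. Qed.

(** Subsets are kept as increasing lists, so that equality of sets is equality of lists. *)
Definition is_block (B : seq nat) := [seq x <- iota 0 22 | x \in B] == B.

Lemma is_block_lt B y : is_block B -> y \in B -> y < 22.
Proof. by move=> /eqP <-; rewrite mem_filter mem_points => /andP[]. Qed.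

Lemma is_block_img l B : is_block (block_img l B).
Proof.
apply/eqP/eq_in_filter => x; rewrite mem_points => lt_x.
by rewrite mem_filter mem_points lt_x andbT.
Qed.

Lemma eq_block (s : {perm 'I_22}) B C : is_block B -> is_block C ->
  (forall i, (val (s i) \in B) = (val (s i) \in C)) -> B = C.
Proof.
move=> /eqP<- /eqP<- eqBC; apply/eq_in_filter => x.
rewrite mem_points => lt_x; have := eqBC (s^-1 (Ordinal lt_x))%g.
by rewrite permKV !mem_filter mem_points lt_x !andbT.
Qed.

Lemma mem_block_img (s : {perm 'I_22}) B (i : 'I_22) : is_block B ->
  (val (s i) \in block_img (code s) B) = (val i \in B).
Proof.
move=> okB; rewrite mem_filter mem_points ltn_ord andbT.
apply/mapP/idP => [[y yB]|iB]; last by exists (val i); rewrite ?nth_code.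
rewrite (nth_code_nat _ (is_block_lt okB yB)) => /val_inj/perm_inj Ei.
by rewrite Ei.
Qed.

Lemma block_img1 B : is_block B -> block_img (code 1) B = B.
Proof.
move=> okB; apply: (@eq_block 1) => // [|i]; first exact: is_block_img.
by rewrite mem_block_img // perm1.
Qed.

Lemma block_imgM s t B : is_block B ->
  block_img (code (s * t)) B = block_img (code t) (block_img (code s) B).
Proof.
move=> okB; apply: (@eq_block (s * t)) => [||i]; rewrite ?is_block_img //.
by rewrite mem_block_img // permM !mem_block_img ?is_block_img.
Qed.

Definition fixes (s : {perm 'I_22}) (F : seq nat) :=
  all (fun x => nth 0 (code s) x == x) F.

Lemma count1_eq (T : eqType) (P : pred T) (l : seq T) x y :
  count P l == 1 -> x \in l -> y \in l -> P x -> P y -> x = y.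
Proof.
rewrite -size_filter => /eqP sz lx ly Px Py.
have : x \in filter P l by rewrite mem_filter Px.
have : y \in filter P l by rewrite mem_filter Py.
by case: filter sz => [|z []] //= _; rewrite !inE => /eqP-> /eqP->.
Qed.

Lemma size_block_img s B : is_block B -> size (block_img (code s) B) = size B.
Proof.
move=> okB; have uniqB : uniq B by rewrite -(eqP okB) filter_uniq ?iota_uniq.
have uniqI : uniq (block_img (code s) B) by rewrite filter_uniq ?iota_uniq.
rewrite -(size_map (nth 0 (code s)) B); apply/perm_size/uniq_perm => //.
  rewrite map_inj_in_uniq // => x y xB yB.
  rewrite (nth_code_nat _ (is_block_lt okB xB)) (nth_code_nat _ (is_block_lt okB yB)).
  by move=> /val_inj/perm_inj/(congr1 val).
move=> x; rewrite mem_filter mem_points; case: mapP => //= -[y yB ->].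
by rewrite (nth_code_nat _ (is_block_lt okB yB)) ltn_ord.
Qed.

Section Invariance.

Variable S : seq (seq nat).
Hypothesis okS : all is_block S.
Hypothesis invS : all (fun l => all (fun B => block_img l B \in S) S) gen_lists.

Lemma block_img_in s B : s \in M22 -> B \in S -> block_img (code s) B \in S.
Proof.
pose P := [set s | all (fun B => block_img (code s) B \in S) S].
have gP : group_set P.
  apply/group_setP; split=> [|x y]; rewrite !inE.
    by apply/allP => C SC; rewrite block_img1 // (allP okS).
  move=> /allP Px /allP Py; apply/allP => C SC.
  by rewrite block_imgM ?(allP okS) // Py // Px.
have genP l : l \in gen_lists -> exists2 s, code s = l & s \in P.
  rewrite -code_gens => lg; have := allP invS l; rewrite -code_gens => /(_ lg).
  by case/mapP: lg => t _ ->; exists t; rewrite ?inE.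
have /subsetP sP := M22_ind gP genP.
by move=> /sP; rewrite inE => /allP; apply.
Qed.

(* A permutation preserving S and fixing F pointwise fixes these blocks.       *)
(* The nested conditionals stand for conjunctions, which vm_compute would not  *)
(* evaluate lazily.                                                            *)
Definition fixed_blocks (F : seq nat) : seq (seq nat) :=
  [seq B <- S | count (fun C => if size C == size B
     then all (fun x => if x \in B then x \in C else true) F else false) S == 1].

Definition fixed_step (F : seq nat) : seq nat :=
  let Bs := fixed_blocks F in
  [seq x <- iota 0 22 | (x \in F) ||
     (count (fun y => if y \in F then false else all (fun B => (x \in B) == (y \in B)) Bs)
        (iota 0 22) == 1)].

(** The image of [B] is a block of the same size that still contains the points of [B] in [F], and
    only one block does. *)
Lemma fixed_blocksP s F B : s \in M22 -> fixes s F -> B \in fixed_blocks F ->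
  block_img (code s) B = B.
Proof.
move=> sM /allP fF; rewrite mem_filter => /andP[cB SB].
have okB := allP okS B SB.
apply/esym/(count1_eq cB SB (block_img_in sM SB)).
  by rewrite eqxx; apply/allP => x _; case: ifP.
rewrite size_block_img // eqxx; apply/allP => x Fx; case: ifP => // xB.
have lt_x := is_block_lt okB xB; have := eqP (fF x Fx).
rewrite (nth_code_nat _ lt_x) => sx.
by rewrite -[X in X \in _]sx mem_block_img.
Qed.

(** A new point x is the only one outside [F] with its incidences to the fixed blocks. Its image has
    the same incidences and, by injectivity, is outside [F], so it is x. *)
Lemma fixed_stepP s F : s \in M22 -> fixes s F -> fixes s (fixed_step F).
Proof.
move=> sM fF; apply/allP => x; rewrite mem_filter mem_points => /andP[+ lt_x].
have [xF _|xF] := boolP (x \in F); first exact: (allP fF).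
rewrite orFb => c1.
have sx_lt : nth 0 (code s) x < 22 by rewrite (nth_code_nat _ lt_x) ltn_ord.
apply/eqP; apply: (count1_eq c1); rewrite ?mem_points //; last first.
  by rewrite (negPf xF); apply/allP => B _; rewrite eqxx.
case: ifP => [sxF|_].
  have := eqP (allP fF _ sxF); rewrite (nth_code_nat _ lt_x) nth_code.
  move=> /val_inj/perm_inj/(congr1 val)/= E.
  by rewrite (nth_code_nat _ lt_x) E (negPf xF) in sxF.
apply/allP => B BF; have EB := fixed_blocksP sM fF BF.
rewrite (nth_code_nat _ lt_x) -{2}EB mem_block_img //.
apply: (allP okS).
by move: BF; rewrite mem_filter => /andP[].
Qed.

End Invariance.

Definition blocks := hexads ++ heptads.

Lemma blocks_ok : all is_block hexads && all is_block blocks.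
Proof. by vm_compute. Qed.

Lemma blocks_inv :
  all (fun l => all (fun B => block_img l B \in hexads) hexads) gen_lists
  && all (fun l => all (fun B => block_img l B \in blocks) blocks) gen_lists.
Proof. by vm_compute. Qed.

(** Two rounds of such deductions reach all 22 points, so these five points form a base of M22. *)
Lemma rigid_check : fixed_step blocks (fixed_step blocks [:: 0; 1; 2; 3; 6]) == iota 0 22.
Proof. by vm_compute. Qed.

Lemma hexad_check : ([:: 0; 1; 2; 6; 9; 19] \in fixed_blocks blocks [:: 0; 1; 2]).
Proof. by vm_compute. Qed.

(* Otherwise closing tactics try to evaluate statements about these lists. *)
Opaque hexads heptads blocks fixed_blocks fixed_step.

Lemma M22_rigid s : s \in M22 -> fixes s [:: 0; 1; 2; 3; 6] -> s = 1%g.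
Proof.
have /andP[_ okS] := blocks_ok; have /andP[_ invS] := blocks_inv.
move=> sM /(fixed_stepP okS invS sM)/(fixed_stepP okS invS sM).
rewrite (eqP rigid_check) {okS invS} => /allP f.
apply/permP => i; apply/val_inj; rewrite perm1.
by have := f i; rewrite mem_points ltn_ord nth_code => /(_ isT)/eqP.
Qed.

(** * An upper bound for the order of M22 *)

Definition pt (k : nat) : 'I_22 := inord k.

(* Kept as a product: 443520 must never be computed in unary. *)
Definition M22_order := 2 ^ 7 * (3 ^ 2 * (5 * (7 * 11))).

Lemma M22_orderE :
  M22_order = (2 * 11) * ((3 * 7) * ((2 ^ 2 * 5) * (2 ^ 4 * 3))).
Proof.
have H a b c d e : a ^ 7 * (b ^ 2 * (c * (d * e)))
    = (a * e) * ((b * d) * ((a ^ 2 * c) * (a ^ 4 * b))) by ring.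
exact: H.
Qed.

Lemma card_ord_count n (P : pred nat) :
  #|[set i : 'I_n | P (val i)]| = count P (iota 0 n).
Proof.
by rewrite -sum1dep_card -(big_mkord P (fun=> 1)) sum1_count /index_iota subn0.
Qed.

(** Stabilizer chain along the base 0, 1, 2, 3, 6, with orbits of sizes at most 22, 21, 20, 16 and
    3. The last two bounds use the hexad through 0, 1, 2: the point 3 moves outside it, the point 6
    among its three other points. *)
Lemma leq_card_M22 : #|M22| <= M22_order.
Proof.
have astabE (G : {group {perm 'I_22}}) x s : s \in 'C_G[x | 'P]%g -> s \in G /\ s x = x.
  by rewrite inE => /andP[sG /astab1P].
pose G1 := 'C_M22[pt 0 | 'P]%G; pose G2 := 'C_G1[pt 1 | 'P]%G.
pose G3 := 'C_G2[pt 2 | 'P]%G; pose G4 := 'C_G3[pt 3 | 'P]%G.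
have stab (G : {group {perm 'I_22}}) x (A : {set 'I_22}) n :
    (forall s, s \in G -> s x \in A) -> #|A| <= n -> #|G| <= n * #|'C_G[x | 'P]%g|.
  move=> GA An; rewrite -(card_orbit_stab 'P G x) leq_mul2r; apply/orP; right.
  apply: leq_trans An; apply/subset_leq_card/subsetP => y /orbitP[s sG <-].
  exact: GA.
have ptE k : k < 22 -> val (pt k) = k by move=> ?; rewrite /= inordK.
have ptV (s : {perm 'I_22}) k : k < 22 -> s (pt k) = pt k -> nth 0 (code s) k == k.
  by move=> lt_k Es; rewrite -{1}(ptE k lt_k) nth_code Es ptE.
have E1 s : s \in G1 -> [/\ s \in M22 & s (pt 0) = pt 0] by case/astabE.
have E2 s : s \in G2 -> [/\ s \in M22, s (pt 0) = pt 0 & s (pt 1) = pt 1].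
  by case/astabE => /E1[].
have E3 s : s \in G3 ->
    [/\ s \in M22, s (pt 0) = pt 0, s (pt 1) = pt 1 & s (pt 2) = pt 2].
  by case/astabE => /E2[].
pose B := [:: 0; 1; 2; 6; 9; 19].
have E3B s : s \in G3 -> forall i, (val (s i) \in B) = (val i \in B).
  case/E3 => sM s0 s1 s2 i.
  have fs : fixes s [:: 0; 1; 2] by rewrite /fixes /= !ptV.
  have EB : block_img (code s) B = B.
    have /andP[_ okS] := blocks_ok; have /andP[_ invS] := blocks_inv.
    exact: (fixed_blocksP okS invS sM fs hexad_check).
  by rewrite -{1}EB mem_block_img.
have E4 s : s \in G4 -> s \in G3 /\ s (pt 3) = pt 3 by case/astabE.
have G5_1 : #|'C_G4[pt 6 | 'P]%g| = 1.
  apply/eqP; rewrite -trivg_card1 -subG1; apply/subsetP => s.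
  case/astabE => /E4[/E3[sM s0 s1 s2] s3] s6; rewrite inE; apply/eqP.
  by apply: M22_rigid => //; rewrite /fixes /= !ptV.
have pt_neq i j : i < 22 -> j < 22 -> (pt i == pt j) = (i == j).
  by move=> lt_i lt_j; rewrite -val_eqE !ptE.
rewrite M22_orderE.
apply: leq_trans (stab _ (pt 0) setT (2 * 11) _ _) _ => [s _||]; rewrite ?inE //.
  by rewrite cardsT card_ord.
rewrite leq_mul2l; apply/orP; right.
apply: leq_trans (stab G1 (pt 1) (~: [set pt 0]) (3 * 7) _ _) _ => [s||].
- case/E1 => _ s0; rewrite !inE -[X in _ == X]s0 (inj_eq perm_inj).
  by rewrite pt_neq.
- by rewrite cardsC1 card_ord.
rewrite leq_mul2l; apply/orP; right.
apply: leq_trans (stab G2 (pt 2) (~: [set pt 0; pt 1]) (2 ^ 2 * 5) _ _) _ => [s||].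
- case/E2 => _ s0 s1; rewrite !inE -s0 -s1 !(inj_eq perm_inj).
  by rewrite !pt_neq.
- by rewrite cardsCs setCK card_ord cards2 pt_neq.
rewrite leq_mul2l; apply/orP; right.
have cardB : #|[set i : 'I_22 | val i \in B]| = 6.
  by rewrite (card_ord_count 22 (fun i => i \in B)).
apply: leq_trans (stab G3 (pt 3) (~: [set i : 'I_22 | val i \in B]) (2 ^ 4) _ _) _ => [s||].
- by move=> sG; rewrite in_setC in_set E3B // ptE.
- by rewrite cardsCs setCK card_ord cardB.
rewrite leq_mul2l; apply/orP; right.
apply: leq_trans (stab G4 (pt 6) ([set i : 'I_22 | val i \in B] :\: [set pt 0; pt 1; pt 2]) 3 _ _) _ => [s||].
- case/E4 => sG _; have [_ s0 s1 s2] := E3 s sG.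
  rewrite in_setD [X in _ && X]in_set E3B // ptE // !inE -s0 -s1 -s2 !(inj_eq perm_inj).
  by rewrite !pt_neq.
- rewrite (_ : _ :\: _ = [set i : 'I_22 | val i \in [:: 6; 9; 19]]).
    by rewrite (card_ord_count 22 (fun i => i \in [:: 6; 9; 19])).
  apply/setP => i; rewrite !inE -!val_eqE !ptE //.
  by case: (val i) => [|[|[|]]].
by rewrite G5_1.
Qed.

(** * Sylow subgroups of M22 *)

Definition word_perm (w : seq nat) : {perm 'I_22} := (\prod_(k <- w) nth 1 gens k)%g.

Definition word_list (w : seq nat) : seq nat :=
  foldr (fun k => lmul (nth [::] gen_lists k)) (iota 0 22) w.

Definition lpow (l : seq nat) i := iter i (lmul l) (iota 0 22).

Lemma code_word w : all (gtn 3) w -> code (word_perm w) = word_list w.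
Proof.
rewrite /word_perm; elim: w => [|k w IH] /=; first by rewrite big_nil code1.
move=> /andP[lt_k lt_w]; rewrite big_cons codeM IH // -code_gens.
by rewrite (nth_map 1%g).
Qed.

Lemma word_perm_in w : all (gtn 3) w -> word_perm w \in M22.
Proof.
move=> lt_w; rewrite /word_perm big_seq; apply: group_prod => k /(allP lt_w) lt_k.
by rewrite mem_gens ?mem_nth.
Qed.

Lemma codeX s i : code (s ^+ i)%g = lpow (code s) i.
Proof. by elim: i => [|i IH]; rewrite ?code1 // expgS codeM IH. Qed.

Definition power_products p (ws : seq (seq nat)) : seq (seq nat) :=
  foldl (fun L w => [seq lmul (lpow (word_list w) i) h | i <- iota 0 p, h <- L])
    [:: iota 0 22] ws.

Definition fix_points l := count (fun i => nth 0 l i == i) (iota 0 22).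

Definition fix_hexads l := count (fun B => block_img l B == B) hexads.

(** The products of powers of the words are p^k distinct elements and are closed under right
    multiplication by the words, so they form a subgroup. Every element of order p in it fixes [a]
    points and [b] hexads, and for odd p the exponent divides p. *)
Definition sylow_check p k a b ws :=
  let L := power_products p ws in
  [&& all (all (gtn 3)) ws, uniq L, size L == p ^ k,
      all (fun l => all (fun w => lmul l (word_list w) \in L) ws) L,
      all (fun l => if l == iota 0 22 then true else
                    if lpow l p == iota 0 22
                    then (fix_points l == a) && (fix_hexads l == b) else true) L
    & odd p ==> all (fun l => lpow l p == iota 0 22) L].

(* Here and below, the words were found by a computer search. *)
Lemma sylow_check2 : sylow_check 2 7 6 13
  [:: [:: 0; 2; 0; 2; 0; 2]; [:: 1; 0; 2; 2; 0; 0; 1]; [:: 1; 0; 1; 2; 0; 0; 1];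
      [:: 0; 2; 2; 2; 0; 0; 1; 2; 2; 2; 0; 2]; [:: 0; 1; 1; 0; 2; 2; 0];
      [:: 2; 1; 0; 2; 1; 2; 0; 2]; [:: 1; 2; 0; 2; 1; 2; 0; 1; 2]].
Proof. by vm_compute. Qed.

Lemma sylow_check3 : sylow_check 3 2 4 5
  [:: [:: 2; 0; 2; 0]; [:: 0; 2; 2; 2; 0; 0; 2; 0; 2; 2]].
Proof. by vm_compute. Qed.

Lemma sylow_check5 : sylow_check 5 1 2 2 [:: [:: 1]].
Proof. by vm_compute. Qed.

Lemma sylow_check7 : sylow_check 7 1 1 0 [:: [:: 0; 2; 1]].
Proof. by vm_compute. Qed.

Lemma sylow_check11 : sylow_check 11 1 0 0 [:: [:: 0]].
Proof. by vm_compute. Qed.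

Lemma power_productsP p (H : {group {perm 'I_22}}) ws l :
    (forall w, w \in ws -> (word_perm w \in H) && all (gtn 3) w) ->
  l \in power_products p ws -> exists2 s, s \in H & code s = l.
Proof.
rewrite /power_products.
have : forall l, l \in [:: iota 0 22] -> exists2 s, s \in H & code s = l.
  by move=> l'; rewrite inE => /eqP->; exists 1%g; rewrite ?code1 ?group1.
elim: ws [:: iota 0 22] => [|w ws IH] L LH wH /=; first exact: LH.
apply: IH => [l'|v ws_v]; last by rewrite wH // inE ws_v orbT.
have /andP[Hw lt_w] := wH w (mem_head _ _).
case/allpairsP=> -[i h] /= [_ /LH[s Hs <-] ->].
by exists (word_perm w ^+ i * s)%g; rewrite ?groupM ?groupX // codeM codeX code_word.
Qed.

Lemma id_power_products p ws : 0 < p -> iota 0 22 \in power_products p ws.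
Proof.
rewrite /power_products => p_gt0.
elim: ws [:: iota 0 22] (mem_head (iota 0 22) [::]) => //= w ws IH L L1.
by apply/IH/allpairsP; exists (0, iota 0 22); rewrite mem_iota.
Qed.

Lemma sylow_checkP p k a b ws : prime p -> sylow_check p k a b ws ->
  exists P : {group {perm 'I_22}},
  [/\ P \subset M22, #|P| = p ^ k,
      forall s, s \in P -> #[s]%g = p ->
        fix_points (code s) = a /\ fix_hexads (code s) = b
    & odd p -> forall s, s \in P -> (s ^+ p = 1)%g].
Proof.
move=> pr_p /and5P[lt_ws uniqL sizeL closL /andP[fixL expL]].
set L := power_products p ws in uniqL sizeL closL fixL expL.
pose P := <<[set s in map word_perm ws]>>%G.
have P_M22 : P \subset M22.
  rewrite gen_subG; apply/subsetP => s; rewrite inE => /mapP[w ws_w ->].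
  by rewrite word_perm_in ?(allP lt_ws).
have wP w : w \in ws -> word_perm w \in P.
  by move=> ws_w; apply: mem_gen; rewrite inE map_f.
have LP l : l \in L -> exists2 s, s \in P & code s = l.
  by apply: power_productsP => w ws_w; rewrite wP // (allP lt_ws).
(* The permutations t such that right multiplication by t maps [L] into itself form a group
   containing the generators; apply t to the identity, which is in [L]. *)
have PL s : s \in P -> code s \in L.
  pose T := [set t | all (fun l => lmul l (code t) \in L) L].
  have gT : group_set T.
    apply/group_setP; split=> [|x y]; rewrite !inE.
      by apply/allP => l Ll; have [z _ zl] := LP l Ll; rewrite -zl -codeM mulg1 zl.
    move=> /allP Tx /allP Ty; apply/allP => l Ll.
    have [z _ zl] := LP l Ll; rewrite -zl -codeM mulgA codeM Ty // codeM zl.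
    exact: Tx.
  have L1 : iota 0 22 \in L by apply/id_power_products/prime_gt0.
  have /subsetP PT : P \subset Group gT.
    rewrite gen_subG; apply/subsetP => t; rewrite inE => /mapP[w ws_w ->].
    rewrite inE; apply/allP => l Ll; rewrite code_word ?(allP lt_ws) //.
    exact: (allP (allP closL l Ll)).
  move/PT; rewrite inE => /allP/(_ _ L1); rewrite -code1 -codeM mul1g; exact.
exists P; split=> //.
- have -> : #|P| = size (map code (enum P)) by rewrite size_map -cardE.
  rewrite -(eqP sizeL); apply/perm_size/uniq_perm => //.
    by rewrite (map_inj_uniq code_inj) enum_uniq.
  move=> l; apply/mapP/idP => [[s]|/LP[s Ps <-]].
    by rewrite mem_enum => /PL Ls ->.
  by exists s; rewrite ?mem_enum.
- move=> s /PL Ls os; have := allP fixL _ Ls.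
  rewrite -codeX -os expg_order -code1 !(inj_eq code_inj) eqxx.
  have -> : (s == 1%g) = false.
    by apply/negbTE/negP => /eqP s1; move: pr_p; rewrite -os s1 order1.
  by case/andP => /eqP-> /eqP->.
move=> odd_p s /PL Ls; have := implyP expL odd_p.
by move/allP/(_ _ Ls); rewrite -codeX -code1 (inj_eq code_inj) => /eqP.
Qed.

Import Order.TTheory GRing.Theory Num.Theory.
Local Open Scope ring_scope.

(** * A congruence for twisted traces *)

(** Orbit lengths divide r^(e+1), and a shorter one would divide r^e and give a fixed point of the
    r^e-th iterate. So all orbits have length r^(e+1), and [F] is constant on each. *)
Lemma dvdz_sum_free_orbits (W : finType) (s : W -> W) (r e : nat)
    (F : W -> int) :
    prime r -> injective s -> (forall w, iter (r ^ e.+1) s w = w) ->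
    (forall w, iter (r ^ e) s w != w) -> (forall w, F (s w) = F w) ->
  ((r ^ e.+1)%:Z %| \sum_w F w)%Z.
Proof.
move=> pr_r inj_s per free invF.
pose p := perm inj_s.
have iterE n w : (p ^+ n)%g w = iter n s w.
  by rewrite permX; elim: n => //= n ->; rewrite permE.
have cardO w : #|porbit p w| = (r ^ e.+1)%N.
  have dv : (#|porbit p w| %| r ^ e.+1)%N.
    have o1 : (p ^+ (r ^ e.+1) = 1)%g by apply/permP => x; rewrite iterE per perm1.
    apply: (@dvdn_trans #[p]%g); last by rewrite order_dvdn o1.
    by rewrite porbitE card_orbit dvdn_indexg.
  have /(dvdn_pfactor _ _ pr_r)[i le_i Ei] := dv.
  move: le_i; rewrite leq_eqVlt => /orP[/eqP <- //|]; rewrite ltnS => le_i.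
  case/negP: (free w); apply/eqP.
  have Hit k : iter (#|porbit p w| * k) s w = w.
    elim: k => [|k IH]; first by rewrite muln0.
    by rewrite mulnS iterD IH -iterE permX iter_porbit.
  by rewrite -(subnKC le_i) expnD -Ei Hit.
rewrite (partition_big (porbit p) (mem (porbits p))) /=; last first.
  by move=> w _; apply: imset_f.
apply: (big_ind (fun x => (_ %| x)%Z)) => [|x y|A]; first exact: dvdz0.
  exact: rpredD.
case/imsetP=> w _ ->.
rewrite (eq_bigl (mem (porbit p w))) => [|x] /=; last by rewrite eq_porbit_mem.
rewrite (eq_bigr (fun _ => F w)) => [|x]; last first.
  case/porbitP=> i ->; rewrite iterE.
  by elim: i => //= i; rewrite invF.
by rewrite sumr_const cardO -mulr_natr natz dvdz_mull.
Qed.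

Section TwistedRotation.

Variables (n' K' : nat).
Let n := n'.+1.
Let K := K'.+1.

(* Its n-th iterate adds 1 to all letters. *)
Definition twisted_rot (w : {ffun 'I_n -> 'I_K}) : {ffun 'I_n -> 'I_K} :=
  [ffun i : 'I_n => if (i.+1 < n)%N then w (inord i.+1) else ordS (w ord0)].

Lemma iter_twisted_rot s w i :
  iter s twisted_rot w i
    = ((w (inord ((i + s) %% n)) + (i + s) %/ n) %% K)%N :> nat.
Proof.
elim: s w i => [|s IH] w i.
  by rewrite addn0 divn_small // (@modn_small i) // addn0 inord_val modn_small.
rewrite iterSr IH ffunE addnS.
have lt_m : ((i + s) %% n < n)%N by rewrite ltn_mod.
rewrite inordK // modnS divnS //; case: ifP => [lt_m1|].
  have -> : (n %| (i + s).+1)%N = false.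
    by apply/negbTE/negP => /eqP; rewrite -addn1 -modnDml addn1 modn_small.
  by rewrite add0n.
move=> /negbT; rewrite -leqNgt => ge_m.
have Em : ((i + s) %% n)%N = n' by apply/eqP; rewrite eqn_leq -ltnS lt_m -ltnS.
have -> : (n %| (i + s).+1)%N by rewrite /dvdn -addn1 -modnDml Em addn1 modnn.
rewrite /= (_ : inord 0 = ord0); last by apply/val_inj; rewrite /= inordK.
by rewrite modnDml add1n addSnnS.
Qed.

Lemma twisted_rot_inj : injective twisted_rot.
Proof.
move=> v w eq_vw; apply/ffunP=> i; apply/val_inj.
have per u : iter (n * K) twisted_rot u i = u i :> nat.
  rewrite iter_twisted_rot (addnC i) (mulnC n) modnMDl divnMDl // divn_small //.
  by rewrite (@modn_small i) // addn0 inord_val modnDr modn_small.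
by rewrite /= -per -(per w) mulSn addSn !iterSr eq_vw.
Qed.

Variables (r j k : nat).
Hypotheses (pr_r : prime r) (nE : n = (r ^ j)%N) (KE : K = (r ^ k.+1)%N).

(** The rotation has period n K = r^(j+k+1), while r^(j+k) = n r^k steps add r^k to every letter,
    which is nonzero modulo K. *)
Lemma dvdz_sum_twisted_rot (F : {ffun 'I_n -> 'I_K} -> int) :
  (forall w, F (twisted_rot w) = F w) ->
  ((r ^ (j + k.+1))%:Z %| \sum_w F w)%Z.
Proof.
move=> invF; rewrite addnS; apply: (dvdz_sum_free_orbits pr_r twisted_rot_inj _ _ invF).
  move=> w; apply/ffunP=> i; apply/ord_inj.
  rewrite iter_twisted_rot -addnS expnD -nE -KE (addnC (nat_of_ord i)) (mulnC n) modnMDl divnMDl //.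
  by rewrite divn_small // (@modn_small i) // addn0 inord_val modnDr modn_small.
move=> w; apply/eqP => /ffunP/(_ ord0)/(congr1 (@nat_of_ord _))/eqP.
rewrite iter_twisted_rot expnD -nE add0n modnMr mulKn //.
rewrite (_ : inord 0 = ord0); last by apply/val_inj; rewrite /= inordK.
have lt_K : (r ^ k < K)%N by rewrite KE ltn_exp2l // prime_gt1.
rewrite -[X in _ == X](modn_small (ltn_ord _)) -[X in _ == X %[mod _]]addn0.
by rewrite eqn_modDl mod0n modn_small // expn_eq0; case: r pr_r.
Qed.

End TwistedRotation.

Section TwistedTrace.

Variables (R : pzRingType) (tr : {additive R -> int}).
Hypothesis trC : forall x y, tr (x * y) = tr (y * x).
Variables (s s' a : R) (r k : nat).
Let K := (r ^ k.+1)%N.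
Let conj (i : nat) := s ^+ i * a * s' ^+ i.
Hypotheses (pr_r : prime r) (ss' : s * s' = 1) (s's : s' * s = 1).
Hypothesis (conjK : conj K = a).

(** Expand the power into words in the conjugates. By cyclicity of the trace the first letter passes
    around to the end, and crossing [s] turns it into the next conjugate. This is [twisted_rot], so
    the traces are invariant under it. *)
Lemma dvdz_trace_twisted_norm j :
  ((r ^ (j + k.+1))%:Z %| tr (s * (\sum_(i < K) conj i) ^+ (r ^ j)))%Z.
Proof.
have [n' nE] : exists n', (r ^ j)%N = n'.+1.
  by exists (r ^ j).-1; rewrite prednK // expn_gt0 prime_gt0.
have [K' KE] : exists K', K = K'.+1.
  by exists K.-1; rewrite prednK // expn_gt0 prime_gt0.
rewrite KE nE -[n'.+1]card_ord -prodr_const bigA_distr_bigA /= mulr_sumr raddf_sum.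
apply: (dvdz_sum_twisted_rot pr_r) => [//|//|w].
(* The wrap from K - 1 to 0 is allowed by [conjK]. *)
have conjS i : conj (ordS i : 'I_K'.+1) = s * conj i * s'.
  have <- : conj i.+1 = s * conj i * s' by rewrite /conj exprS exprSr !mulrA.
  have := ltn_ord i; rewrite leq_eqVlt => /orP[/eqP E|lt_i] /=; last first.
    by rewrite modn_small.
  by rewrite E modnn -KE conjK /conj mul1r mulr1.
rewrite big_ord_recr /= [in RHS]big_ord_recl /=.
have -> : \prod_(i < n') conj (twisted_rot w (widen_ord (leqnSn n') i))
   = \prod_(i < n') conj (w (lift ord0 i)).
  apply: eq_bigr => i _; rewrite ffunE /= ltnS ltn_ord.
  by congr (conj (w _)); apply/val_inj; rewrite /= inordK // ltnS.
rewrite ffunE /= ltnn conjS.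
move: (conj (w ord0)) (\prod_(i < n') _) => c b.
by rewrite !mulrA trC !mulrA s's mul1r -mulrA trC.
Qed.

End TwistedTrace.

Definition eqmodn (R : pzRingType) (d : nat) (x y : R) := exists z, x = y + z *+ d.

Lemma eqmodn_expr (R : pzRingType) d n (x y : R) :
  eqmodn d x y -> eqmodn d (x ^+ n) (y ^+ n).
Proof.
move=> [z ->]; elim: n => [|n [w IH]]; first by exists 0; rewrite mul0rn addr0.
exists (y * w + z * (y ^+ n + w *+ d)); rewrite !exprS IH.
set q := y ^+ n + w *+ d.
by rewrite mulrDl {1}/q mulrDr mulrnAr mulrnAl mulrnDl addrA.
Qed.

(** If y = x^(r^j) is 1 modulo r^(j+1), then y^r - 1 is y - 1 times the sum of the y^i for i < r,
    and that sum is divisible by r. *)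
Lemma eqmodn1_expr (R : pzRingType) r j (x : R) :
  eqmodn r x 1 -> eqmodn (r ^ j.+1) (x ^+ (r ^ j)) 1.
Proof.
move=> x1; elim: j => [|j [z IH]]; first by rewrite expn1 expn0 expr1.
rewrite (expnSr r j) exprM IH.
have sumE m : exists v, \sum_(i < m) (1 + z *+ r ^ j.+1) ^+ i = m%:R + v *+ r.
  elim: m => [|m [v IHm]]; first by exists 0; rewrite big_ord0 mul0rn addr0.
  have [|w Ew] := @eqmodn_expr _ r m (1 + z *+ r ^ j.+1) 1.
    by exists (z *+ r ^ j); rewrite -mulrnA expnSr.
  exists (v + w); rewrite big_ord_recr /= IHm Ew expr1n mulrnDl.
  by rewrite -[m.+1]addn1 natrD addrACA.
have [v Ev] := sumE r; exists (z * (1 + v)); rewrite -[LHS](subrK 1) subrX1 Ev addrC; congr (_ + _).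
rewrite [1 + _ in LHS]addrC addrK -mulrnDl mulrnAl mulrnAr -mulrnA.
by rewrite -expnS.
Qed.

Section TwistedTraceVanishing.

Variables (R : pzRingType) (tr : {additive R -> int}).
Hypothesis trC : forall x y, tr (x * y) = tr (y * x).
Variables (s s' a t : R) (r k m : nat).
Let K := (r ^ k.+1)%N.
Let conj (i : nat) := s ^+ i * a * s' ^+ i.
Hypotheses (pr_r : prime r) (ss' : s * s' = 1) (s's : s' * s = 1).
Hypothesis (conjK : conj K = a).
Hypothesis norm_a : eqmodn r (\sum_(i < K) conj i) 1.
Hypotheses (ts : GRing.comm t s) (tm : t ^+ m = 1) (co_mr : coprime m r).

(** Apply the congruence to a B instead of a, where B = A^(r^j - 1) t. As B commutes with [s'], the
    conjugates of a B add up to A^(r^j) t, which is t modulo r^(j+1). Its r^j-th power is therefore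
    t^(r^j) modulo r^(j+1), and this equals t for suitable j. *)
Lemma trace_twisted_eq0 : tr (s * t) = 0.
Proof.
have := norm_a; set A := \sum_(i < K) conj i => normA.
have ts' : GRing.comm t s'.
  by rewrite /GRing.comm -[LHS]mul1r -s's !mulrA -(mulrA s') -ts !mulrA -(mulrA _ s) ss' mulr1.
have sA : GRing.comm s A.
  have sconj i : s * conj i = conj i.+1 * s.
    by rewrite /conj exprS exprSr -!mulrA s's mulr1.
  have [K' KE] : exists K', K = K'.+1.
    by exists K.-1; rewrite prednK // expn_gt0 prime_gt0.
  rewrite /GRing.comm mulr_sumr; under eq_bigr do rewrite sconj.
  rewrite -mulr_suml.
  congr (_ * s); rewrite /A KE big_ord_recr [RHS]big_ord_recl /= -KE conjK addrC.
  by rewrite /conj !expr0 mul1r mulr1.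
have s'A : GRing.comm s' A.
  by rewrite /GRing.comm -[LHS]mulr1 -ss' !mulrA -(mulrA s') -sA mulrA s's mul1r.
have r_gt1 := prime_gt1 pr_r.
have dvd_tr i : ((r ^ i)%:Z %| tr (s * t))%Z.
  (* By Euler's theorem this exponent j gives t^(r^j) = t; the factor i makes j at least i. *)
  have m_r1 : (r ^ (totient m * i) = 1 %[mod m])%N.
    by rewrite expnM -modnXm Euler_exp_totient 1?coprime_sym // modnXm exp1n.
  set j := (totient m * i)%N in m_r1.
  have tj : t ^+ (r ^ j) = t.
    by rewrite -(expr_mod _ tm) m_r1 expr_mod.
  set B := A ^+ (r ^ j).-1 * t.
  have Bs' l : B * s' ^+ l = s' ^+ l * B.
    apply: commrX; apply: commr_sym; apply: commrM; last exact: commr_sym.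
    exact: commrX.
  have conjB l : s ^+ l * (a * B) * s' ^+ l = conj l * B.
    by rewrite /conj mulrA -(mulrA _ B) Bs' !mulrA.
  have := dvdz_trace_twisted_norm trC (s := s) (s' := s') (a := a * B) (k := k) pr_r.
  rewrite conjB conjK => /(_ s's erefl j).
  under eq_bigr do rewrite conjB.
  rewrite -mulr_suml -/A /B mulrA -exprS prednK ?expn_gt0 ?prime_gt0 //.
  have [z ->] := eqmodn1_expr j normA.
  have [|w ->] := @eqmodn_expr _ (r ^ j.+1) (r ^ j) ((1 + z *+ r ^ j.+1) * t) t.
    by exists (z * t); rewrite mulrDl mul1r mulrnAl.
  rewrite tj mulrDr raddfD mulrnAr raddfMn /= => dvd_sum.
  have le_ij : (i <= j)%N.
    rewrite leq_pmull // totient_gt0; case: (m) co_mr => //.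
    by rewrite /coprime gcd0n => /eqP r1; rewrite r1 in r_gt1.
  have dvd_w : ((r ^ i)%:Z %| tr (s * w) *+ r ^ j.+1)%Z.
    rewrite -mulr_natr natz dvdz_mull //; apply: dvdn_exp2l.
    exact: leq_trans le_ij _.
  have : ((r ^ i)%:Z %| tr (s * t) + tr (s * w) *+ r ^ j.+1)%Z.
    apply: dvdz_trans dvd_sum; apply: dvdn_exp2l.
    by rewrite (leq_trans le_ij) // leq_addr.
  by rewrite rpredDr.
(* A nonzero integer x is not divisible by r^|x|, which exceeds |x|. *)
apply/eqP; rewrite -absz_eq0 -leqn0 leqNgt; apply/negP => x_gt0.
have := dvdn_leq x_gt0 (dvd_tr (absz (tr (s * t))) : (_ %| _)%N).
by rewrite absz_nat leqNgt ltn_expl.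
Qed.

End TwistedTraceVanishing.

(** * Vanishing of class sums *)

Section Extension.

Variables (gT : finGroupType) (A : pzRingType) (P : gT -> A).
Hypotheses (P1 : P 1%g = 1) (PM : forall g h, P (g * h)%g = P g * P h).
Implicit Types u v : group_ring int gT.

Definition extend u : A := \sum_g P g *~ coeff u g.

Lemma extend1 : extend 1 = 1.
Proof.
rewrite /extend (bigD1 1%g) //= {1}/coeff ffunE eqxx P1 big1 ?addr0 // => g.
by move=> /negPf ng; rewrite /coeff ffunE ng.
Qed.

Lemma extendM u v : extend (u * v) = extend u * extend v.
Proof.
rewrite /extend mulr_suml; under [RHS]eq_bigr do rewrite mulr_sumr.
rewrite [RHS](eq_bigr (fun g => \sum_k P k *~ (coeff u g * coeff v (g^-1 * k)%g))).
  rewrite exchange_big /=; apply: eq_bigr => k _.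
  by rewrite /coeff ffunE -mulrz_sumr.
move=> g _; rewrite [RHS](reindex_inj (mulgI g)) /=; apply: eq_bigr => h _.
by rewrite mulKg PM mulrzAl mulrzAr mulrzA_C.
Qed.

Lemma extendX u n : extend (u ^+ n) = extend u ^+ n.
Proof. by elim: n => [|n IH]; rewrite ?extend1 // !exprS extendM IH. Qed.

Lemma comm_extend (x : A) u :
  (forall g, GRing.comm x (P g)) -> GRing.comm x (extend u).
Proof.
move=> cx; rewrite /GRing.comm mulr_sumr mulr_suml; apply: eq_bigr => g _.
by rewrite mulrzAr mulrzAl cx.
Qed.

End Extension.

Section FunctionMatrices.

Variable X : finType.

Definition fun_mx (f : X -> X) : 'M[int]_#|X| :=
  \matrix_(i, j) (enum_val i == f (enum_val j))%:R.

Definition ind_mx (c : pred X) : 'M[int]_#|X| :=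
  \matrix_(i, j) ((i == j) && c (enum_val i))%:R.

Lemma eq_fun_mx f g : f =1 g -> fun_mx f = fun_mx g.
Proof. by move=> fg; apply/matrixP => i j; rewrite !mxE fg. Qed.

Lemma eq_ind_mx c d : c =1 d -> ind_mx c = ind_mx d.
Proof. by move=> cd; apply/matrixP => i j; rewrite !mxE cd. Qed.

Lemma fun_mx_id : fun_mx id = 1.
Proof.
by apply/matrixP => i j; rewrite !mxE (inj_eq enum_val_inj).
Qed.

Lemma fun_mxM f g : fun_mx f * fun_mx g = fun_mx (f \o g).
Proof.
apply/matrixP => i j; rewrite !mxE (bigD1 (enum_rank (g (enum_val j)))) //=.
rewrite !mxE enum_rankK eqxx mulr1 big1 ?addr0 // => k ne.
rewrite !mxE; case: (enum_val k =P _) => [E|_]; last by rewrite mulr0.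
by case/eqP: ne; rewrite -E enum_valK.
Qed.

Lemma fun_mx_ind f f' c : cancel f f' -> cancel f' f ->
  fun_mx f * ind_mx c * fun_mx f' = ind_mx (c \o f').
Proof.
move=> fK f'K.
have -> : fun_mx f * ind_mx c = ind_mx (c \o f') * fun_mx f.
  apply/matrixP => i j; rewrite !mxE (bigD1 j) //= big1 ?addr0 => [|k ne]; last first.
    by rewrite !mxE (negPf ne) mulr0.
  rewrite (bigD1 i) //= [X in _ = _ + X]big1 ?addr0 => [|k ne]; last first.
    by rewrite !mxE eq_sym (negPf ne) mul0r.
  rewrite !mxE !eqxx /=; case: eqP => [->|_]; last by rewrite mul0r mulr0.
  by rewrite fK mul1r mulr1.
rewrite -mulrA fun_mxM (@eq_fun_mx _ id) ?fun_mx_id ?mulr1 //.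
Qed.

Lemma mxtrace_fun f : \tr (fun_mx f) = #|[pred x | f x == x]|%:R.
Proof.
rewrite -[#|[pred _ | _]|]sum1_card natr_sum big_mkcond /=.
rewrite [RHS](reindex _ (onW_bij _ (@enum_val_bij X))) /=.
by apply: eq_bigr => i _; rewrite mxE inE eq_sym; case: eqP.
Qed.

End FunctionMatrices.

(** The colour of h is its exponent of y relative to the chosen representative of its left coset of
    the group generated by y. *)
Lemma exists_colouring (gT : finGroupType) (y : gT) (r : nat) :
    (r %| #[y]%g)%N ->
  exists c : gT -> nat, forall h, c (h * y)%g = (c h).+1 %[mod r].
Proof.
move=> r_y; pose rp h := repr (h *: <[y]>)%g.
have ex h : exists i, (y ^+ i == (rp h)^-1 * h)%g.
  have : rp h \in (h *: <[y]>)%g by apply/mem_repr/lcoset_refl.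
  rewrite mem_lcoset => /groupVr; rewrite invMg invgK.
  by case/cycleP=> i ->; exists i.
exists (fun h => xchoose (ex h)) => h.
have := xchooseP (ex h); have := xchooseP (ex (h * y)%g).
move: (xchoose _) (xchoose _) => j i.
have -> : rp (h * y)%g = rp h by rewrite /rp lcosetM lcoset_id ?cycle_id.
rewrite mulgA => /eqP E1 /eqP E2; move: E1; rewrite -E2 -expgSr => /eqP.
by rewrite eq_expg_mod_order => /eqP E; rewrite -(modn_dvdm _ r_y) E modn_dvdm.
Qed.

Lemma sum_dvdn_shift (r c : nat) : (0 < r)%N ->
  \sum_(i < r) (r %| c + i)%N%:R = 1 :> int.
Proof.
move=> r_gt0; pose k := Ordinal (ltn_pmod (r - c %% r) r_gt0).
have div_k : (r %| c + k)%N.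
  by rewrite /dvdn /= modnDmr -modnDml subnKC ?modnn // ltnW ?ltn_pmod.
rewrite (bigD1 k) //= div_k big1 ?addr0 // => i ne_ik.
case: (boolP (r %| c + i)%N) => // div_i; case/eqP: ne_ik; apply/val_inj.
have : c + i = c + k %[mod r] by rewrite (eqP div_i) (eqP div_k).
by move/eqP; rewrite eqn_modDl !modn_small // => /eqP.
Qed.

(* If the action of s ^+ 2 is induced, with f the projection onto one half of   *)
(* the pieces, then the action of s is induced modulo 2: a is an explicit      *)
(* witness, by an argument from Tate cohomology in characteristic 2.           *)
Section QuarterTurn.

Variables (A : pzRingType) (s s' f g : A).
Hypotheses (ss' : s * s' = 1) (s's : s' * s = 1).
Hypothesis conj2 : s ^+ 2 * f * s' ^+ 2 = 1 - f.
Hypothesis gE : s * f * s' = g.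
Let a := f * g - f.
Let conj (i : nat) := s ^+ i * a * s' ^+ i.

Let conjE : [/\ conj 1 = - (g * f), conj 2 = f * g - g,
  conj 3 = f + g - g * f - 1 & conj 4 = a].
Proof.
pose c x := s * x * s'.
have cM x y : c (x * y) = c x * c y by rewrite /c !mulrA -(mulrA _ s' s) s's mulr1.
have cB x y : c (x - y) = c x - c y by rewrite /c mulrBr mulrBl.
have cD x y : c (x + y) = c x + c y by rewrite /c mulrDr mulrDl.
have cN x : c (- x) = - c x by rewrite /c mulrN mulNr.
have c1 : c 1 = 1 by rewrite /c mulr1.
have cf : c f = g := gE.
have cg : c g = 1 - f by rewrite -conj2 /c -gE !expr2 !mulrA.
have conjS i : conj i.+1 = c (conj i) by rewrite /conj /c exprS exprSr !mulrA.
have E0 : conj 0 = f * g - f by rewrite /conj !expr0 mul1r mulr1.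
have E1 : conj 1 = - (g * f).
  by rewrite conjS E0 cB cM cf cg mulrBr mulr1 addrAC subrr add0r.
have E2 : conj 2 = f * g - g.
  by rewrite conjS E1 cN cM cf cg mulrBl mul1r opprB.
have E3 : conj 3 = f + g - g * f - 1.
  by rewrite conjS E2 cB cM cf cg mulrBr mulr1 opprB addrACA (addrC g) !addrA.
split=> //; rewrite conjS E3 !(cB, cD, cM) cf cg c1 mulrBl mul1r /a opprB.
by rewrite [X in X - 1]addrC addrA subrK [1 - f]addrC addrA addrK.
Qed.

Lemma quarter_turn_conj4 : conj 4 = a.
Proof. by case: conjE. Qed.

Lemma quarter_turn_norm : eqmodn 2 (\sum_(i < 2 ^ 2) conj i) 1.
Proof.
exists (f * g - g * f - 1); rewrite !big_ord_recr big_ord0 /= add0r.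
have [-> -> -> _] := conjE; rewrite /conj !expr0 mul1r mulr1 /a mulr2n.
rewrite [RHS]addrA [in RHS](addrC 1) subrK [f * g - f + _]addrAC.
rewrite [f * g - g * f - f + _]addrACA -opprD.
rewrite -(addrA (f + g)) [LHS]addrA.
by rewrite subrK !addrA.
Qed.

End QuarterTurn.

Section ClassSums.

Variable gT : finGroupType.
Implicit Types u v : group_ring int gT.

(* The trace of m |-> u m x^-1 on ZG. *)
Definition class_sum u (x : gT) : int := \sum_h coeff u (x ^ h)%g.

Let L (g : gT) := fun_mx (fun h : gT => g * h)%g.
Let Rm (x : gT) := fun_mx (fun h : gT => h * x^-1)%g.

Let L1 : L 1%g = 1.
Proof. by rewrite -fun_mx_id; apply: eq_fun_mx => h; rewrite mul1g. Qed.

Let LM g h : L (g * h)%g = L g * L h.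
Proof. by rewrite fun_mxM; apply: eq_fun_mx => k; rewrite /= mulgA. Qed.

Let Rm1 : Rm 1%g = 1.
Proof. by rewrite -fun_mx_id; apply: eq_fun_mx => h; rewrite invg1 mulg1. Qed.

Let RmM x y : Rm (x * y)%g = Rm x * Rm y.
Proof. by rewrite fun_mxM; apply: eq_fun_mx => k; rewrite /= invMg mulgA. Qed.

Let RmX x n : Rm (x ^+ n)%g = Rm x ^+ n.
Proof. by elim: n => [|n IH]; rewrite ?Rm1 // expgS exprS RmM IH. Qed.

Let RL x g : GRing.comm (Rm x) (L g).
Proof. by rewrite /GRing.comm !fun_mxM; apply: eq_fun_mx => k; rewrite /= mulgA. Qed.

Let E u := extend L u.

Let RE x u : Rm x * E u = E u * Rm x.
Proof. exact: comm_extend. Qed.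

Let trC (A B : 'M[int]_#|gT|) : \tr (A * B) = \tr (B * A).
Proof. exact: mxtrace_mulC. Qed.

(** The equation g h x^-1 = h says that g is the conjugate of x by h^-1, so the diagonal counts the
    ways of conjugating x to g. *)
Let trE u x : \tr (E u * Rm x) = class_sum u x.
Proof.
rewrite mulr_suml raddf_sum /=.
transitivity (\sum_g \sum_(h | (x ^ h)%g == g) coeff u g).
  apply: eq_bigr => g _; rewrite mulrzAl raddfMz /= fun_mxM mxtrace_fun.
  rewrite sumr_const mulrzz -[RHS]mulr_natl; congr (_%:R * _).
  rewrite -(card_imset _ (@invg_inj gT)); apply: eq_card => h.
  rewrite -[h in LHS]invgK (mem_imset _ _ (@invg_inj gT)) !inE.
  rewrite [RHS]unfold_in /= mulgA; apply/eqP/eqP => [/(canRL (mulgKV _)) Ex|<-].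
    by rewrite conjgE mulgA -Ex mulgKV.
  by rewrite conjgE !mulgA mulgK mulgK.
rewrite (exchange_big_dep predT) //=; apply: eq_bigr => h _.
by rewrite (big_pred1 (x ^ h)%g).
Qed.

Let RmK y : Rm y * Rm y^-1%g = 1.
Proof. by rewrite -RmM mulgV Rm1. Qed.

Let Rm_ind y d : Rm y * ind_mx d * Rm y^-1%g = ind_mx (fun h => d (h * y)%g).
Proof.
by rewrite fun_mx_ind => [|h|h]; rewrite ?invgK ?mulgKV ?mulgK.
Qed.

Section Vanishing.

Variables (r m n : nat) (x : gT).
Hypothesis pr_r : prime r.

(** Take for s the right action of the r-part of x, and for t the action of u times that of the
    r'-part, which has order prime to r. The indicator of the colour 0 modulo r has r conjugates
    under s, which add up to exactly 1. *)
Lemma class_sum_eq0 u : u ^+ n = 1 -> ~~ (r %| n)%N -> (r %| #[x]%g)%N ->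
  class_sum u x = 0.
Proof.
move=> un r_n r_x.
have [c cS] : exists c : gT -> nat, forall h, c (h * x.`_r)%g = (c h).+1 %[mod r].
  apply: exists_colouring; rewrite order_constt p_part.
  by rewrite dvdn_exp // logn_gt0 mem_primes pr_r order_gt0.
have cX i h : c (h * x.`_r ^+ i)%g = (c h + i)%N %[mod r].
  elim: i => [|i IH]; first by rewrite mulg1 addn0.
  by rewrite expgSr mulgA cS -addn1 -modnDml IH modnDml addn1 addnS.
have conjE i : Rm x.`_r ^+ i * ind_mx (fun h => r %| c h)%N * Rm (x.`_r)^-1%g ^+ i
    = ind_mx (fun h => r %| c h + i)%N.
  rewrite -!RmX expgVn Rm_ind; apply: eq_ind_mx => h.
  by rewrite /dvdn cX.
rewrite -trE -{1}[x](consttC r) RmM mulrA -RE -mulrA.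
apply: (trace_twisted_eq0 trC (r := r) (k := 0) (m := n * #[x.`_r^']%g)
  (a := ind_mx (fun h => r %| c h)%N) (s' := Rm (x.`_r)^-1%g)) => //.
- by rewrite -RmM mulVg Rm1.
- by rewrite conjE expn1; apply: eq_ind_mx => h; rewrite dvdn_addl.
- exists 0; rewrite mul0rn addr0; under eq_bigr do rewrite conjE.
  apply/matrixP => i j; rewrite summxE !mxE; under eq_bigr do rewrite mxE.
  case: eqP => [_|_] /=; last by rewrite big1.
  exact/sum_dvdn_shift/prime_gt0.
- rewrite /GRing.comm [RHS]mulrA RE -!mulrA -!RmM consttC.
  by rewrite -(consttNK r x) consttC.
- rewrite exprMn_comm; last by rewrite /GRing.comm RE.
  rewrite {1}exprM -extendX // un extend1 // expr1n mul1r -RmX mulnC expgM.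
  by rewrite expg_order expg1n Rm1.
- rewrite coprimeMl coprime_sym prime_coprime // r_n order_constt.
  by rewrite coprime_sym prime_coprime // -p'natE // part_pnat.
Qed.

(** Now u may have even order, so its 2-part T, the action of u^m, is moved into s. Then s no longer
    permutes colours, but s^2 is the right action of y^2 and exchanges two colours, because 4
    divides the order of y. The quarter turn lemmas provide the element a. *)
Lemma class_sum4_eq0 u : u ^+ (2 * m) = 1 -> odd m -> (4 %| #[x]%g)%N ->
  class_sum u x = 0.
Proof.
move=> um odd_m x4; set y := (x.`_2%N)%g.
have [c cS] : exists c : gT -> nat, forall h, c (h * y ^+ 2)%g = (c h).+1 %[mod 2].
  have [k y2] : exists k, #[y]%g = (2 ^ k.+2)%N.
    exists (logn 2 #[x]%g).-2; rewrite order_constt p_part; congr (2 ^ _)%N.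
    by move: x4; rewrite (@pfactor_dvdn 2 2) //; case: (logn _ _) => [|[]].
  by apply: exists_colouring; rewrite orderXdiv y2 expnS ?mulKn // ?expnS dvdn_mulr.
set T := E (u ^+ m).
have TT : T * T = 1 by rewrite -extendM // -exprD addnn -mul2n um extend1.
pose s := T * Rm y; pose s' := T * Rm y^-1%g.
have ss' : s * s' = 1 by rewrite /s /s' mulrA -(mulrA T) RE mulrA TT mul1r RmK.
have s's : s' * s = 1.
  by rewrite /s /s' mulrA -(mulrA T) RE mulrA TT mul1r -RmM mulVg Rm1.
have s2 : s * s = Rm (y ^+ 2)%g.
  by rewrite /s mulrA -(mulrA T) RE mulrA TT mul1r -RmM.
have s'2 : s' * s' = Rm (y ^+ 2)^-1%g.
  by rewrite /s' mulrA -(mulrA T) RE mulrA TT mul1r -RmM -invMg.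
pose phi := ind_mx (fun h => odd (c h)).
have conj2 : s ^+ 2 * phi * s' ^+ 2 = 1 - phi.
  rewrite !expr2 s2 s'2 Rm_ind; apply/matrixP=> i j.
  rewrite !mxE; case: eqP => [_|_] /=; last by rewrite subr0.
  have := cS (enum_val i); rewrite !modn2 oddS.
  by case: (odd (c (enum_val i))); case: (odd _).
pose w := (x.`_(2%N)^')%g.
(* u = u^m u^(m+1) since u^(2m) = 1. As m + 1 is even, the order of u^(m+1) divides the odd number
   m. *)
have uxE : s * (E (u ^+ m.+1) * Rm w) = E u * Rm x.
  rewrite /s mulrA -(mulrA T) RE mulrA -extendM // -exprD addnS addnn -mul2n.
  by rewrite exprSr um mul1r -mulrA -RmM consttC.
rewrite -trE -uxE.
apply: (trace_twisted_eq0 trC (r := 2) (k := 1) (m := m * #[w]%g)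
  (a := phi * (s * phi * s') - phi) (s' := s')) => //.
- rewrite -[(2 ^ 2)%N]/4%N; exact: (quarter_turn_conj4 ss' s's conj2 erefl).
- exact: (quarter_turn_norm ss' s's conj2 erefl).
- rewrite /GRing.comm uxE /s mulrA -(mulrA (E _)) RE mulrA -extendM //.
  rewrite -exprD addSn addnn -mul2n exprS um mulr1 -mulrA -RmM.
  rewrite /w /y.
  by rewrite -(consttNK 2%N x) consttC.
- rewrite exprMn_comm; last by rewrite /GRing.comm RE.
  rewrite {1}exprM -extendX // -exprM.
  have -> : (m.+1 * m = 2 * m * m.+1./2)%N.
    by rewrite -{1}[m.+1]odd_double_half /= odd_m /= -mul2n mulnAC.
  rewrite exprM um expr1n extend1 // expr1n mul1r -RmX mulnC expgM.
  by rewrite expg_order expg1n Rm1.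
rewrite coprimen2 oddM odd_m /= order_constt.
by rewrite -coprimen2 coprime_sym prime_coprime // -p'natE // part_pnat.
Qed.

End Vanishing.

End ClassSums.

(** * Eigenvalues of torsion matrices *)

(** The minimal polynomial divides X^n - 1, which has distinct roots. *)
Lemma unity_mx_diag (N n : nat) (A : 'M[algC]_N) : (0 < n)%N -> A ^+ n = 1 ->
  exists2 P : 'M[algC]_N, P \in unitmx &
  exists2 d : 'I_N -> algC, forall i, d i ^+ n = 1
    & forall k, A ^+ k = invmx P *m diag_mx (\row_i d i ^+ k) *m P.
Proof.
move=> n_gt0; case: N A => [|N'] A An.
  exists 1%:M; rewrite ?unitmx1 //; exists (fun _ => 0) => [[]//|k].
  by apply/matrixP => [[]].
have [z prim_z] := C_prim_root_exists n_gt0.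
have [P Pu /(mxpoly.diagonalizable_forLR Pu)[d Ed]] : mxpoly.diagonalizable A.
  apply/mxpoly.diagonalizableP; exists [seq z ^+ i | i <- index_iota 0 n].
    rewrite map_inj_in_uniq ?iota_uniq // => i j; rewrite !mem_index_iota.
    move=> /= ltin ltjn /eqP; rewrite (eq_prim_root_expr prim_z) !modn_small //.
    by move/eqP.
  rewrite big_map factor_Xn_sub_1 //; apply: mxminpoly_min.
  by rewrite rmorphB rmorphXn /= horner_mx_X rmorph1 An subrr.
rewrite mxpoly.conjVmx // in Ed; exists P => //.
have AX k : A ^+ k = invmx P *m diag_mx (\row_i d 0 i ^+ k) *m P.
  elim: k => [|k IH].
    rewrite (_ : diag_mx _ = 1%:M) ?mulmx1 ?mulVmx //.
    by apply/matrixP=> i j; rewrite !mxE.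
  rewrite exprS IH Ed -[LHS]/(_ *m _) !mulmxA mulmxK // -(mulmxA _ (diag_mx d)).
  rewrite mulmx_diag; congr (_ *m diag_mx _ *m _).
  by apply/rowP=> j; rewrite !mxE exprS.
exists (d 0) => // i; have := AX n; rewrite An.
move=> /(congr1 (fun B => P *m B *m invmx P)).
rewrite !mulmxA mulmxV // mul1mx mulmxK // mulmx1 mulmxV // => /matrixP/(_ i i).
by rewrite !mxE eqxx.
Qed.

Section TorsionMatrices.

Variables (N n : nat) (M : 'M[int]_N).
Hypotheses (n_gt0 : (0 < n)%N) (Mn : M ^+ n = 1).

Let toC (B : 'M[int]_N) : 'M[algC]_N := map_mx intr B.

Let toCX k : toC (M ^+ k) = toC M ^+ k.
Proof.
elim: k => [|k IH]; first by rewrite !expr0 /toC map_mx1.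
by rewrite !exprS -IH /toC -[M * _]/(M *m _) map_mxM.
Qed.

Let toCn : toC M ^+ n = 1.
Proof. by rewrite -toCX Mn /toC map_mx1. Qed.

Lemma torsion_mx_trace : exists2 d : 'I_N -> algC, forall i, d i ^+ n = 1 &
  forall k, (\tr (M ^+ k))%:~R = \sum_i d i ^+ k.
Proof.
have [P Pu [d dn Ed]] := unity_mx_diag n_gt0 toCn; exists d => // k.
rewrite -[LHS](@trace_map_mx _ _ intr) -/(toC _) toCX Ed.
rewrite mxtrace_mulC mulmxA mulmxV // mul1mx mxtrace_diag.
by apply: eq_bigr => i _; rewrite mxE.
Qed.

(** A field automorphism raising n-th roots of unity to the k-th power sends tr M to tr (M^k), but
    fixes the integer tr M. *)
Lemma torsion_mx_trace_coprime k : coprime k n -> \tr (M ^+ k) = \tr M.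
Proof.
move=> co_kn; have [d dn trE] := torsion_mx_trace.
have [u uE] := Qn_aut_exists co_kn.
apply: (@intr_inj algC); rewrite trE -[M in RHS]expr1 -[RHS](rmorph_int u) trE.
by rewrite rmorph_sum; apply: eq_bigr => i _; rewrite expr1 uE.
Qed.

(** The N eigenvalues have modulus 1 and sum e N. The triangle inequality gives |e| = 1, and its
    case of equality makes every eigenvalue equal to e. *)
Lemma torsion_mx_trace_scalar (e : int) : (0 < N)%N -> e != 0 ->
  \tr M = e * N%:Z -> M = e%:M.
Proof.
move=> N_gt0 e_n0 trM; have [P Pu [d dn Ed]] := unity_mx_diag n_gt0 toCn.
have N_n0 : N%:R != 0 :> algC by rewrite pnatr_eq0 -lt0n.
have d1 i : `|d i| = 1.
  by apply/eqP; rewrite -(@pexpr_eq1 _ _ n) ?normr_ge0 // -normrX dn normr1.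
have trE : e%:~R * N%:R = \sum_i d i.
  have := congr1 (intr : int -> algC) trM; rewrite -(@trace_map_mx _ _ intr).
  rewrite -/(toC M) -[toC M]expr1 Ed mxtrace_mulC mulmxA mulmxV // mul1mx.
  rewrite mxtrace_diag intrM => <-; apply: eq_bigr => i _; by rewrite mxE expr1.
have sum1 : \sum_i `|d i| = N%:R.
  by rewrite (eq_bigr _ (fun i _ => d1 i)) sumr_const card_ord.
have e1 : `|e%:~R| = 1 :> algC.
  apply/eqP; rewrite eq_le; apply/andP; split.
    rewrite -(ler_pM2r (_ : 0 < N%:R)) ?ltr0n // -{1}(@normr_nat _ N) -normrM.
    by rewrite trE mul1r -sum1 ler_norm_sum.
  by rewrite -intr_norm -[1]/(1%:~R) ler_int -gtz0_ge1 normr_gt0.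
have [] := @normC_sum_eq1 _ _ predT d.
- by rewrite -trE sum1 normrM e1 mul1r normr_nat.
- by move=> i _; apply: d1.
move=> t _ dE; have te : t = e%:~R.
  apply: (mulIf N_n0); rewrite trE (eq_bigr _ dE) sumr_const card_ord.
  by rewrite mulr_natr.
have : toC M = e%:~R%:M.
  rewrite -[toC M]expr1 Ed (_ : diag_mx _ = e%:~R%:M).
    by rewrite -mulmxA mul_scalar_mx -scalemxAr mulVmx // scalemx1.
  by apply/matrixP=> i j; rewrite !mxE expr1 dE // te.
move=> /matrixP ME; apply/matrixP => i j; apply: (@intr_inj algC).
by have := ME i j; rewrite !mxE => ->; case: eqP.
Qed.

End TorsionMatrices.

(** * Eigenvalue multiplicities for a product of two primes *)

Lemma sum_unity_expr (z : algC) n : z ^+ n = 1 ->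
  \sum_(i < n) z ^+ i = n%:R *+ (z == 1).
Proof.
move=> zn; have [->|z1] := eqVneq z 1.
  by under eq_bigr do rewrite expr1n; rewrite sumr_const card_ord.
by apply: (mulfI (_ : z - 1 != 0)); rewrite ?subr_eq0 // -subrX1 zn subrr mulr0.
Qed.

Lemma sum_dvdn_mul (R : nmodType) (p q : nat) (F : nat -> R) : (0 < p)%N ->
  \sum_(m < p * q | (p %| m)%N) F m = \sum_(l < q) F (p * l)%N.
Proof.
move=> p_gt0; rewrite -(big_mkord (fun m => p %| m)%N F) -(big_mkord predT (fun l => F (p * l)%N)).
elim: q => [|q IH]; first by rewrite muln0 !big_nil.
rewrite (big_cat_nat (n := p * q)) ?leq_pmul2l //= IH big_nat_recr //=; congr (_ + _).
rewrite big_mkcond big_ltn ?ltn_pmul2l // dvdn_mulr // big1_seq ?Monoid.mulm1 // => i.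
rewrite mem_index_iota /= mulnS addnC => /andP[lt_i i_lt].
rewrite -(subnKC (ltnW lt_i)) dvdn_addr ?dvdn_mulr // gtnNdvd ?subn_gt0 //.
by rewrite ltn_subLR // ltnW.
Qed.

Section TwoPrimes.

Variables (N p q : nat) (M : 'M[int]_N).
Hypotheses (pr_p : prime p) (pr_q : prime q) (ne_pq : p != q).
Hypothesis Mpq : M ^+ (p * q) = 1.

(** k is the multiplicity of the eigenvalue z^-1, and k p q is the sum of z^m tr (M^m) over m < p
    q. *)
Lemma torsion_mx_mult (z : algC) : z ^+ (p * q) = 1 -> exists k : nat,
  (k * (p * q))%:Z = N%:Z
     + ((p * (z ^+ q == 1%R))%N%:Z - 1) * \tr (M ^+ q)
     + ((q * (z ^+ p == 1%R))%N%:Z - 1) * \tr (M ^+ p)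
     + ((p * (z ^+ q == 1%R))%N%:Z - 1) * ((q * (z ^+ p == 1%R))%N%:Z - 1) * \tr M.
Proof.
move=> zpq; have p_gt0 := prime_gt0 pr_p; have q_gt0 := prime_gt0 pr_q.
have pq_gt0 : (0 < p * q)%N by rewrite muln_gt0 p_gt0.
have z_n0 : z != 0.
  by apply: contra_eq_neq zpq => ->; rewrite expr0n gtn_eqF // eq_sym oner_eq0.
have [d dn trE] := torsion_mx_trace pq_gt0 Mpq.
exists #|[pred i | d i == z^-1]|; apply: (@intr_inj algC).
(* The trace depends only on gcd(m, p q). The inclusion-exclusion form leaves sums of z^m over the
   multiples of 1, p, q and p q. *)
have trC m : \tr (M ^+ m) = \tr M + (\tr (M ^+ p) - \tr M) *+ (p %| m)%N
    + (\tr (M ^+ q) - \tr M) *+ (q %| m)%N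
    + (N%:Z - \tr (M ^+ p) - \tr (M ^+ q) + \tr M) *+ ((p %| m) && (q %| m))%N.
  have Mp : (M ^+ p) ^+ q = 1 by rewrite -exprM.
  have Mq : (M ^+ q) ^+ p = 1 by rewrite -exprM mulnC.
  case: (boolP (p %| m)%N) => [/dvdnP[a ->]|p_m].
    case: (boolP (q %| _)%N) => [q_m|].
      have /dvdnP[b ->] : (p * q %| a * p)%N.
        rewrite Gauss_dvd; first by rewrite q_m dvdn_mull.
        by rewrite prime_coprime // dvdn_prime2.
      rewrite mulnC exprM Mpq expr1n mxtrace1 /= !mulr1n natz; ring.
    rewrite Euclid_dvdM // negb_or => /andP[q_a _]; rewrite mulnC exprM.
    rewrite (torsion_mx_trace_coprime q_gt0 Mp) ?addr0; first by rewrite addrC subrK.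
    by rewrite coprime_sym prime_coprime.
  case: (boolP (q %| m)%N) => [/dvdnP[a Ea]|q_m].
    rewrite Ea mulnC exprM addr0.
    rewrite (torsion_mx_trace_coprime p_gt0 Mq) ?addr0; first by rewrite addrC subrK.
    rewrite coprime_sym prime_coprime //; apply: contra p_m => p_a.
    by rewrite Ea dvdn_mulr.
  rewrite !addr0 (torsion_mx_trace_coprime pq_gt0 Mpq) //.
  by rewrite coprimeMr !(coprime_sym m) !prime_coprime // p_m.
transitivity (\sum_(m < p * q) z ^+ m * (\tr (M ^+ m))%:~R).
  under [RHS]eq_bigr do rewrite trE mulr_sumr.
  rewrite exchange_big /= -pmulrn natrM -sum1_card natr_sum mulr_suml big_mkcond.
  apply: eq_bigr => i _; under eq_bigr do rewrite -exprMn.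
  rewrite sum_unity_expr ?exprMn ?zpq ?dn ?mulr1 // inE mul1r.
  rewrite -(inj_eq (mulfI z_n0)) divff //.
  by case: eqP => _; rewrite ?mulr1n ?mulr0n // mul1r.
have sumE a : (0 < a)%N -> forall b, (a * b = p * q)%N ->
    \sum_(m < p * q) z ^+ m *+ (a %| m)%N = b%:R *+ (z ^+ a == 1).
  move=> a_gt0 b ab; rewrite -sum_unity_expr -?exprM ?ab //.
  under [RHS]eq_bigr do rewrite -exprM.
  rewrite -(sum_dvdn_mul _ (fun m => z ^+ m) a_gt0) ab [RHS]big_mkcond /=.
  by apply: eq_bigr => m _; case: ifP.
under eq_bigr do rewrite trC !(intrD, intrB) !mulrDr.
rewrite !big_split /=.
have mulE (P : nat -> bool) (c : int) :
    \sum_(m < p * q) z ^+ m * (c *+ P m)%:~R = c%:~R * \sum_(m < p * q) z ^+ m *+ P m.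
  rewrite mulr_sumr; apply: eq_bigr => m _.
  by case: (P m); rewrite ?mulr1n ?mulr0n ?mulr0 // mulrC.
have E1 : \sum_(m < p * q) z ^+ m * (\tr M)%:~R
    = (\tr M)%:~R * ((p * q)%:R *+ ((z ^+ p == 1) && (z ^+ q == 1))).
  rewrite -mulr_suml mulrC sum_unity_expr //; congr (_ * (_ *+ _)); congr nat_of_bool.
  apply/eqP/andP => [->|[/eqP zp /eqP zq]]; first by rewrite !expr1n.
  have [u v uv _] := egcdnP q p_gt0.
  have := congr1 (fun k => z ^+ k) uv; rewrite mulnC exprM zp expr1n exprD.
  rewrite mulnC exprM zq expr1n mul1r => /esym.
  by rewrite (eqP (_ : coprime p q)) ?expr1 // prime_coprime // dvdn_prime2.
have dvd_pq m : ((p %| m) && (q %| m))%N = (p * q %| m)%N.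
  by rewrite Gauss_dvd // prime_coprime // dvdn_prime2.
have E4 : \sum_(m < p * q) z ^+ m *+ ((p %| m) && (q %| m))%N = 1.
  under eq_bigr do rewrite dvd_pq.
  by rewrite (sumE _ pq_gt0 1%N) ?muln1 // zpq eqxx.
rewrite E1 (mulE (fun m => p %| m)%N) (mulE (fun m => q %| m)%N).
rewrite (mulE (fun m => (p %| m) && (q %| m))%N) E4.
rewrite (sumE _ p_gt0 q) // (sumE _ q_gt0 p) 1?mulnC //.
rewrite !(intrD, intrM, intrB) natrM.
case: (_ == 1); case: (_ == 1); rewrite /= ?muln1 ?muln0 ?mulr1n ?mulr0n.
all: rewrite ?pmulrn; ring.
Qed.

End TwoPrimes.

(** * Torsion units and permutation characters *)

Lemma mulmxzE (V : zmodType) m n (A : 'M[V]_(m, n)) (z : int) i j :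
  (A *~ z) i j = A i j *~ z.
Proof. by case: z => k; rewrite ?NegzE ?mulrNz ?mxE -!pmulrn mulmxnE. Qed.

Lemma mxtrace_extend (gT : finGroupType) (X : finType) (a : gT -> X -> X)
    (u : group_ring int gT) :
  \tr (extend (fun g => fun_mx (a g)) u)
    = \sum_g coeff u g * #|[pred x | a g x == x]|%:Z.
Proof.
rewrite raddf_sum; apply: eq_bigr => g _.
by rewrite raddfMz /= mxtrace_fun mulrzz natz mulrC.
Qed.

Section TorsionUnits.

Variable gT : finGroupType.
Implicit Types u v : group_ring int gT.

Lemma augmentationX u n : augmentation (u ^+ n) = augmentation u ^+ n.
Proof.
have E v : augmentation v = extend (fun _ => 1 : int) v.
  by apply: eq_bigr => g _; rewrite intz.
by rewrite !E extendX // => *; rewrite mulr1.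
Qed.

Lemma sum_class_function u (F : gT -> int) :
    (forall g h, F (g ^ h)%g = F g) ->
  #|gT|%:Z * \sum_g coeff u g * F g = \sum_g F g * class_sum u g.
Proof.
move=> FJ; under [RHS]eq_bigr do rewrite mulr_sumr.
rewrite exchange_big /= -sum1_card.
rewrite (big_morph Posz PoszD (erefl _)) mulr_suml.
apply: eq_bigr => h _; rewrite mul1r (reindex_inj (conjg_inj h)) /=.
by apply: eq_bigr => g _; rewrite FJ mulrC.
Qed.

Lemma augmentation_class_sum u :
  #|gT|%:Z * augmentation u = \sum_g class_sum u g.
Proof.
rewrite (eq_bigr (fun g => 1 * class_sum u g)) => [|g _]; last by rewrite mul1r.
rewrite -(@sum_class_function u (fun _ => 1)) //; congr (_ * _).
by apply: eq_bigr => g _; rewrite mulr1.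
Qed.

(** The regular representation of u has trace |G| times the coefficient at 1. If that is nonzero, u
    acts as a scalar, so u is a multiple of 1, and augmentation 1 gives u = 1. *)
Lemma class_sum1_eq0 u n :
  has_order u n -> (1 < n)%N -> augmentation u = 1 -> class_sum u 1%g = 0.
Proof.
move=> [n_gt0 un minu] n_gt1 aug1.
have cs1 : class_sum u 1%g = #|gT|%:Z * coeff u 1%g.
  rewrite /class_sum; under eq_bigr do rewrite conj1g.
  by rewrite sumr_const -natz mulr_natl.
rewrite cs1; have [->|e_n0] := eqVneq (coeff u 1%g) 0; first by rewrite mulr0.
pose L (g : gT) := fun_mx (fun h : gT => g * h)%g.
have L1 : L 1%g = 1.
  by rewrite -fun_mx_id; apply: eq_fun_mx => h; rewrite mul1g.
have LM g h : L (g * h)%g = L g * L h.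
  by rewrite fun_mxM; apply: eq_fun_mx => k; rewrite /= mulgA.
have Mn : extend L u ^+ n = 1 by rewrite -extendX // un extend1.
have LE h : extend L u (enum_rank h) (enum_rank 1%g) = coeff u h.
  rewrite summxE (bigD1 h) //= big1 ?addr0 => [|g ne_gh].
    by rewrite mulmxzE !mxE !enum_rankK mulg1 eqxx intz.
  by rewrite mulmxzE !mxE !enum_rankK mulg1 eq_sym (negPf ne_gh) mul0rz.
have trM : \tr (extend L u) = coeff u 1%g * #|gT|%:Z.
  rewrite mxtrace_extend (bigD1 1%g) //= big1 ?addr0 => [|g ne_g].
    by congr (_ * Posz _); apply: eq_card => h; rewrite !inE mul1g eqxx.
  rewrite eq_card0 ?mulr0 // => h; rewrite !inE -{2}[h]mul1g.
  by rewrite (inj_eq (mulIg h)) (negPf ne_g).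
have Me : extend L u = (coeff u 1%g)%:M.
  apply: (torsion_mx_trace_scalar n_gt0 Mn _ e_n0 trM).
  by apply/card_gt0P; exists 1%g.
have u0 h : h != 1%g -> coeff u h = 0.
  move=> h1; rewrite -LE Me mxE (inj_eq enum_rank_inj) (negPf h1).
  by rewrite mulr0n.
have u1 : u = 1.
  apply/ffunP => h; rewrite -/(coeff u h) ffunE; have [->|h1] := eqVneq h 1%g.
    by rewrite -[RHS]aug1 /augmentation (bigD1 1%g) //= big1 ?addr0.
  by rewrite u0.
by case: (minu 1%N); rewrite ?n_gt1 // u1 expr1.
Qed.

(** Argue on the r-part of x for each prime r. A prime not dividing n is excluded by
    [class_sum_eq0], an odd r^2 by hypothesis, and 4 by [class_sum4_eq0], because an even n is then
    twice an odd number. *)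
Lemma class_sum_support u n x :
    has_order u n -> augmentation u = 1 -> (1 < n)%N -> ~~ (4 %| n)%N ->
    (forall r (g : gT), prime r -> odd r -> (r %| n)%N -> ~~ (r ^ 2 %| #[g]%g)%N) ->
  class_sum u x != 0 -> #[x]%g != 1%N /\ (#[x]%g %| n)%N.
Proof.
move=> ord_u aug1 n_gt1 n4 sqf; have [n_gt0 un _] := ord_u.
move=> cs_n0; split.
  apply: contra cs_n0; rewrite order_eq1 => /eqP->.
  by rewrite (class_sum1_eq0 ord_u).
apply/dvdn_partP => // r; rewrite inE mem_primes => /and3P[pr_r _ r_x].
have r_n : (r %| n)%N by apply: contraR cs_n0 => r_n; rewrite (class_sum_eq0 pr_r un).
case: (boolP (r ^ 2 %| #[x]%g)%N) => [r2|]; last first.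
  rewrite pfactor_dvdn // -ltnNge ltnS p_part => le1.
  by rewrite (dvdn_trans (dvdn_exp2l r le1)) ?expn1.
have [odd_r|] := boolP (odd r).
  by case/negP: (sqf r x pr_r odd_r r_n).
move/(prime_oddPn pr_r) => r2E; rewrite r2E in r2 r_n.
have nE : n = (2 * n./2)%N.
  by rewrite mul2n -{1}[n]odd_double_half -[odd n]negbK -dvdn2 r_n.
case/eqP: cs_n0; apply: (class_sum4_eq0 (m := n./2)) => //; first by rewrite -nE.
apply: contraR n4; rewrite -dvdn2 => d2.
by rewrite nE -[4%N]/(2 * 2)%N dvdn_mul.
Qed.

End TorsionUnits.

Lemma fixed_points_conj (gT : finGroupType) (X : finType) (a : gT -> X -> X) g h :
    a 1%g =1 id -> (forall x y z, a (x * y)%g z = a x (a y z)) ->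
  #|[pred x | a (g ^ h)%g x == x]| = #|[pred x | a g x == x]|.
Proof.
move=> a1 aM; have ainj k : injective (a k).
  by move=> x y /(congr1 (a k^-1%g)); rewrite -!aM mulVg !a1.
rewrite -(card_imset _ (ainj h)); apply: eq_card => x.
rewrite -[x in LHS]a1 -[1%g](mulgV h) aM (mem_imset _ _ (ainj h)) !inE.
by rewrite conjgE -(inj_eq (ainj h)) -!aM !mulgA !mulgV !mul1g mulgK a1.
Qed.

Section PermutationCharacter.

Variables (gT : finGroupType) (X : finType) (a : gT -> X -> X) (p q : nat).
Hypotheses (a1 : a 1%g =1 id) (aM : forall g h x, a (g * h)%g x = a g (a h x)).
Hypotheses (pr_p : prime p) (pr_q : prime q) (ne_pq : p != q).
Hypothesis no_pq : forall g : gT, #[g]%g != (p * q)%N.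
Hypothesis no_r2 : forall r (g : gT), (r == p) || (r == q) -> odd r ->
  ~~ (r ^ 2 %| #[g]%g)%N.

Let fix_card (g : gT) := #|[pred x | a g x == x]|.

Variables (fp fq : nat).
Hypothesis fix_p : forall g : gT, #[g]%g = p -> fix_card g = fp.
Hypothesis fix_q : forall g : gT, #[g]%g = q -> fix_card g = fq.

Variable u : group_ring int gT.
Hypotheses (aug_u : augmentation u = 1) (ord_u : has_order u (p * q)).

Let rep v := extend (fun g => fun_mx (a g)) v.

Let rep1 : fun_mx (a 1%g) = 1.
Proof. by rewrite -fun_mx_id; apply: eq_fun_mx => x; rewrite a1. Qed.

Let repM g h : fun_mx (a (g * h)%g) = fun_mx (a g) * fun_mx (a h).
Proof. by rewrite fun_mxM; apply: eq_fun_mx => x; rewrite aM. Qed.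

Let fix_cardJ g h : (fix_card (g ^ h)%g : int) = fix_card g.
Proof. by rewrite /fix_card fixed_points_conj. Qed.

Let sum_eq0 v (F : gT -> int) : (forall g h, F (g ^ h)%g = F g) ->
    (forall g, class_sum v g != 0 -> F g = 0) ->
  \sum_g coeff v g * F g = 0.
Proof.
move=> FJ F0; apply: (@mulfI _ #|gT|%:Z).
  by rewrite -lt0n; apply/card_gt0P; exists 1%g.
rewrite sum_class_function // mulr0 big1 // => g _.
by have [->|/F0->] := eqVneq (class_sum v g) 0; rewrite ?mulr0 ?mul0r.
Qed.

Let trace_prime_order r fr v : (r == p) || (r == q) -> has_order v r ->
    augmentation v = 1 -> (forall g : gT, #[g]%g = r -> fix_card g = fr) ->
  \tr (rep v) = fr%:Z.
Proof.
move=> r_pq ord_v aug_v fix_r.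
have pr_r : prime r by case/orP: r_pq => /eqP->.
rewrite mxtrace_extend -[RHS]mul1r -aug_v mulr_suml; apply/eqP.
rewrite -subr_eq0 -sumrB; under eq_bigr do rewrite -mulrBr.
rewrite sum_eq0 // => [g h|g /(class_sum_support ord_v aug_v (prime_gt1 pr_r))].
  by rewrite -/(fix_card _) fix_cardJ.
case=> [||g1 g_r].
- by rewrite (@pfactor_dvdn 2 2) ?prime_gt0 // logn_prime //; case: (_ == r).
- move=> r' h pr_r' odd_r'; rewrite dvdn_prime2 // => /eqP r'E.
  by apply: no_r2; rewrite // r'E.
have /eqP g_r2 : #[g]%g == r by case/primeP: pr_r => _ /(_ _ g_r); rewrite (negPf g1).
by rewrite -/(fix_card _) fix_r // subrr.
Qed.

Let ord_p : has_order (u ^+ q) p.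
Proof.
have [_ upq minu] := ord_u; split; first exact: prime_gt0.
  by rewrite -exprM mulnC.
move=> m /andP[m_gt0 m_p]; rewrite -exprM; apply: minu.
by rewrite muln_gt0 prime_gt0 //= m_gt0 mulnC ltn_pmul2r // prime_gt0.
Qed.

Let ord_q : has_order (u ^+ p) q.
Proof.
have [_ upq minu] := ord_u; split; first exact: prime_gt0.
  by rewrite -exprM.
move=> m /andP[m_gt0 m_q]; rewrite -exprM; apply: minu.
by rewrite muln_gt0 prime_gt0 //= m_gt0 ltn_pmul2l // prime_gt0.
Qed.

(** The class sums of u live on orders p and q. By augmentation 1, the coefficients over these two
    sets of elements have sums c and 1 - c. *)
Let trace_pq : exists c : int, \tr (rep u) = c * fp%:Z + (1 - c) * fq%:Z.
Proof.
exists (\sum_g coeff u g * (#[g]%g == p)%:R).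
have supp g : class_sum u g != 0 -> (#[g]%g == p) || (#[g]%g == q).
  case/(class_sum_support ord_u aug_u) => [|||g1 g_pq].
  - by rewrite -[1%N]muln1 ltn_mul ?prime_gt1.
  - rewrite (@pfactor_dvdn 2 2) ?muln_gt0 ?prime_gt0 // lognM ?prime_gt0 //.
    rewrite !logn_prime //; case: (2%N =P p) => [pE|_]; case: (2%N =P q) => // qE.
    by move: ne_pq; rewrite -pE -qE.
  - move=> r h pr_r odd_r r_pq; apply: no_r2 => //.
    by move: r_pq; rewrite Euclid_dvdM // !dvdn_prime2.
  case: (boolP (p %| #[g]%g)%N) => [/dvdnP[e Eg]|p_g]; last first.
    have g_q : (#[g]%g %| q)%N.
      by rewrite -(Gauss_dvdr _ (_ : coprime #[g]%g p)) // coprime_sym prime_coprime.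
    case/primeP: pr_q => _ /(_ _ g_q)/orP[|->]; last by rewrite orbT.
    by rewrite (negPf g1).
  have e_q : (e %| q)%N.
    by rewrite -(@dvdn_pmul2r p) ?prime_gt0 // -Eg mulnC.
  case/primeP: pr_q => _ /(_ _ e_q)/orP[]/eqP eE; first by rewrite Eg eE mul1n eqxx.
  by case/negP: (no_pq g); rewrite Eg eE mulnC.
have aug : \sum_g coeff u g * (1 - (#[g]%g == p)%:R - (#[g]%g == q)%:R) = 0.
  apply: sum_eq0 => [g h|g /supp/orP[]/eqP->]; rewrite ?orderJ // eqxx.
    by rewrite (negPf ne_pq) /=; ring.
  by rewrite eq_sym (negPf ne_pq) /=; ring.
have trE : \sum_g coeff u g * ((fix_card g)%:Z - fp%:Z * (#[g]%g == p)%:R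
                               - fq%:Z * (#[g]%g == q)%:R) = 0.
  apply: sum_eq0 => [g h|g /supp/orP[]/eqP gE]; rewrite ?fix_cardJ ?orderJ //.
    by rewrite fix_p // gE eqxx (negPf ne_pq) /=; ring.
  by rewrite fix_q // gE eqxx eq_sym (negPf ne_pq) /=; ring.
set c := \sum_g _; set c' := \sum_g coeff u g * (#[g]%g == q)%:R.
have augE : 1 - c - c' = 0.
  rewrite -[RHS]aug -[X in X - c]aug_u -!sumrB; apply: eq_bigr => g _; ring.
have {augE}<- : c' = 1 - c by apply/eqP; rewrite eq_sym -subr_eq0 augE.
rewrite mxtrace_extend; apply/eqP; rewrite -subr_eq0 opprD addrA -[X in _ == X]trE.
apply/eqP; rewrite !mulr_suml -!sumrB; apply: eq_bigr => g _.
by rewrite -/(fix_card g); ring.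
Qed.

Lemma unit_pq_multiplicities : exists c : int, let t := c * fp%:Z + (1 - c) * fq%:Z in
  exists k : nat * nat * nat * nat,
  [/\ (k.1.1.1 * (p * q))%:Z = #|X|%:Z + (p%:Z - 1) * fp%:Z + (q%:Z - 1) * fq%:Z
         + (p%:Z - 1) * (q%:Z - 1) * t,
      (k.1.1.2 * (p * q))%:Z = #|X|%:Z - fp%:Z + (q%:Z - 1) * fq%:Z - (q%:Z - 1) * t,
      (k.1.2 * (p * q))%:Z = #|X|%:Z + (p%:Z - 1) * fp%:Z - fq%:Z - (p%:Z - 1) * t
    & (k.2 * (p * q))%:Z = #|X|%:Z - fp%:Z - fq%:Z + t].
Proof.
have [c trE] := trace_pq; exists c => t.
have [pq_gt0 upq _] := ord_u.
have trX n : \tr (rep u ^+ n) = \tr (rep (u ^+ n)) by rewrite /rep extendX.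
have aug1 n : augmentation (u ^+ n) = 1 by rewrite augmentationX aug_u expr1n.
have trp : \tr (rep u ^+ q) = fp.
  by rewrite trX; apply: trace_prime_order ord_p _ fix_p; rewrite ?eqxx.
have trq : \tr (rep u ^+ p) = fq.
  by rewrite trX; apply: trace_prime_order ord_q _ fix_q; rewrite ?eqxx ?orbT.
have Mpq : rep u ^+ (p * q) = 1 by rewrite /rep -extendX // upq extend1.
have mult z := torsion_mx_mult pr_p pr_q ne_pq Mpq (z := z).
rewrite {}trE {}trp {}trq -/t in mult.
(* The roots 1, w^q, w^p, w have orders 1, p, q, p q and give the four multiplicities in turn. *)
have [w prim_w] := C_prim_root_exists pq_gt0.
have p_q : ~~ (p %| q)%N by rewrite dvdn_prime2.
have q_p : ~~ (q %| p)%N by rewrite dvdn_prime2 // eq_sym.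
have w1 m : (w ^+ m == 1) = (p * q %| m)%N by rewrite -(prim_order_dvd prim_w).
have [k0] := mult 1 (expr1n _ _).
rewrite !expr1n eqxx !muln1 => E0.
have [|k1] := mult (w ^+ q); first by rewrite -exprM; apply/eqP; rewrite w1 dvdn_mull.
rewrite -!exprM !w1 dvdn_pmul2r ?prime_gt0 // (negPf p_q) [(q * p)%N]mulnC dvdnn.
rewrite muln0 muln1 => E1.
have [|k2] := mult (w ^+ p); first by rewrite -exprM; apply/eqP; rewrite w1 dvdn_mull.
rewrite -!exprM !w1 dvdnn dvdn_pmul2l ?prime_gt0 // (negPf q_p) muln0 muln1 => E2.
have [|k3] := mult w; first by apply/eqP; rewrite w1.
have wp : (p * q %| p)%N = false.
  by rewrite -{2}[p]muln1 dvdn_pmul2l ?prime_gt0 // dvdn1 gtn_eqF ?prime_gt1.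
have wq : (p * q %| q)%N = false.
  by rewrite -{2}[q]mul1n dvdn_pmul2r ?prime_gt0 // dvdn1 gtn_eqF ?prime_gt1.
rewrite !w1 wp wq !muln0 => E3.
by exists (k0, k1, k2, k3); split; rewrite /= ?E0 ?E1 ?E2 ?E3; ring.
Qed.

End PermutationCharacter.

(** * Group elements as units, and units of prime order *)

Section Elements.

Variable gT : finGroupType.

Definition group_elt (g : gT) : group_ring int gT := [ffun h => (h == g)%:R : int].

Lemma group_eltM g h : group_elt g * group_elt h = group_elt (g * h)%g.
Proof.
apply/ffunP => k; rewrite !ffunE (bigD1 g) //= big1 ?addr0 => [|x ne_x].
  by rewrite /coeff !ffunE eqxx mul1r -(inj_eq (mulgI g)) mulKVg.
by rewrite /coeff ffunE (negPf ne_x) mul0r.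
Qed.

Lemma group_elt1 : group_elt 1%g = 1.
Proof. by apply/ffunP => k; rewrite !ffunE. Qed.

Lemma group_eltX g n : group_elt g ^+ n = group_elt (g ^+ n)%g.
Proof.
by elim: n => [|n IH]; rewrite ?group_elt1 // exprS expgS IH group_eltM.
Qed.

Lemma group_elt_normalized g : normalized_unit (group_elt g).
Proof.
split; first by exists (group_elt g^-1%g); rewrite !group_eltM mulgV mulVg group_elt1.
rewrite /augmentation (bigD1 g) //= big1 => [|h ne_h]; rewrite /coeff ffunE.
  by rewrite eqxx addr0.
by rewrite (negPf ne_h).
Qed.

Lemma group_elt_order g : has_order (group_elt g) #[g]%g.
Proof.
split=> [||m /andP[m_gt0 m_lt]]; first exact: order_gt0.
  by rewrite group_eltX expg_order group_elt1.
rewrite group_eltX => /ffunP/(_ 1%g); rewrite !ffunE eqxx => /eqP.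
have [/esym/eqP|//] := 1%g =P (g ^+ m)%g.
rewrite -order_dvdn => /(dvdn_leq m_gt0).
by rewrite leqNgt m_lt.
Qed.

Lemma prime_order_unit_dvdn p (u : group_ring int gT) : prime p ->
  has_order u p -> augmentation u = 1 -> (p %| #|gT|)%N.
Proof.
move=> pr_p ord_u aug_u; apply: contraTT isT => p_G.
have ndvd (x : gT) : ~~ (p %| #[x]%g)%N.
  by apply: contra p_G => /dvdn_trans -> //; rewrite -cardsT order_dvdG ?inE.
suff cs0 x : class_sum u x = 0.
  have /eqP := augmentation_class_sum u; rewrite aug_u mulr1 big1 //.
  by move=> /eqP[] /eqP; rewrite gtn_eqF //; apply/card_gt0P; exists 1%g.
apply/eqP; apply: contraT => /(class_sum_support ord_u aug_u (prime_gt1 pr_p)).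
case=> [||x1 x_p].
- by rewrite (@pfactor_dvdn 2 2) ?prime_gt0 // logn_prime //; case: (_ == p).
- move=> r g pr_r _; rewrite dvdn_prime2 // => /eqP->.
  by apply: contra (ndvd g); apply: dvdn_trans; rewrite dvdn_mulr.
case/negP: (ndvd x); case/primeP: pr_p => _ /(_ _ x_p).
by rewrite (negPf x1) => /eqP->.
Qed.

End Elements.

Local Close Scope ring_scope.

(** * Units of ZM22 *)

Section M22Facts.

Variables (gT : finGroupType) (f : {morphism [set: gT] >-> {perm 'I_22}}).
Hypotheses (inj_f : ('injm f)%g) (im_f : (f @* [set: gT])%g = M22).

Let fM x y : f (x * y)%g = (f x * f y)%g.
Proof. by rewrite morphM ?inE. Qed.

Let f_in x : f x \in M22.
Proof. by rewrite -im_f mem_morphim ?inE. Qed.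

Let f_order x : #[f x]%g = #[x]%g.
Proof. by rewrite order_injm ?inE. Qed.

Let card_gT : #|gT| = #|M22|.
Proof. by rewrite -im_f card_injm // cardsT. Qed.

Lemma card_M22 : #|gT| = M22_order.
Proof.
have dvdP r k a b ws : prime r -> sylow_check r k a b ws -> (r ^ k %| #|M22|)%N.
  move=> pr_r /(sylow_checkP pr_r)[P [P_M22 <- _ _]]; exact: cardSg.
have D : (M22_order %| #|M22|)%N.
  have d5 := dvdP _ _ _ _ _ _ sylow_check5; have d7 := dvdP _ _ _ _ _ _ sylow_check7.
  have d11 := dvdP _ _ _ _ _ _ sylow_check11.
  rewrite expn1 in d5; rewrite expn1 in d7; rewrite expn1 in d11.
  rewrite /M22_order; do 4 (rewrite Gauss_dvd; last by vm_compute).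
  rewrite d5 // d7 // d11 // (dvdP _ _ _ _ _ _ sylow_check2) //.
  by rewrite (dvdP _ _ _ _ _ _ sylow_check3).
apply/eqP; rewrite card_gT eqn_leq leq_card_M22 dvdn_leq ?cardG_gt0 //.
Qed.


(* Permutations compose from left to right, hence the inverses. *)
Definition act_point (g : gT) (i : 'I_22) : 'I_22 := f g^-1%g i.

Definition act_hexad (g : gT) (i : 'I_77) : 'I_77 :=
  inord (index (block_img (code (f g^-1%g)) (nth [::] hexads i)) hexads).

Lemma act_point1 : act_point 1%g =1 id.
Proof. by move=> i; rewrite /act_point invg1 morph1 perm1. Qed.

Lemma act_pointM g h i : act_point (g * h)%g i = act_point g (act_point h i).
Proof. by rewrite /act_point invMg fM permM. Qed.

Let size_hexads : size hexads = 77. Proof. by vm_compute. Qed.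

Let uniq_hexads : uniq hexads. Proof. by vm_compute. Qed.

Let nth_hexad (i : 'I_77) : nth [::] hexads i \in hexads.
Proof. by rewrite mem_nth // size_hexads. Qed.

Let ok_hexad i : is_block (nth [::] hexads (i : 'I_77)).
Proof.
have /andP[/allP okH _] := blocks_ok; apply: okH; exact: nth_hexad.
Qed.

Let img_hexad g i : block_img (code (f g)) (nth [::] hexads (i : 'I_77)) \in hexads.
Proof.
have /andP[okH _] := blocks_ok; have /andP[invH _] := blocks_inv.
exact: (block_img_in okH invH (f_in g) (nth_hexad i)).
Qed.

Lemma nth_act_hexad g i :
  nth [::] hexads (act_hexad g i) = block_img (code (f g^-1%g)) (nth [::] hexads i).
Proof.
rewrite inordK; first by rewrite nth_index // img_hexad.
by rewrite -[X in _ < X]size_hexads index_mem img_hexad.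
Qed.

Let hexad_inj (i j : 'I_77) : nth [::] hexads i = nth [::] hexads j -> i = j.
Proof.
by move/eqP; rewrite nth_uniq ?size_hexads // => /eqP/val_inj.
Qed.

Lemma act_hexad1 : act_hexad 1%g =1 id.
Proof.
by move=> i; apply: hexad_inj; rewrite nth_act_hexad invg1 morph1 block_img1 ?ok_hexad.
Qed.

Lemma act_hexadM g h i : act_hexad (g * h)%g i = act_hexad g (act_hexad h i).
Proof.
by apply: hexad_inj; rewrite !nth_act_hexad invMg fM block_imgM ?ok_hexad.
Qed.

Let fix_pointE g :
  #|[pred i | act_point g i == i]| = fix_points (code (f g^-1%g)).
Proof.
rewrite /fix_points -(card_ord_count 22) cardsE; apply: eq_card => i.
by rewrite inE [RHS]unfold_in nth_code.
Qed.

Let fix_hexadE g :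
  #|[pred i | act_hexad g i == i]| = fix_hexads (code (f g^-1%g)).
Proof.
rewrite /fix_hexads -[in RHS](mkseq_nth [::] hexads) count_map size_hexads.
rewrite -(card_ord_count 77) cardsE; apply: eq_card => i.
rewrite inE [RHS]unfold_in /= -nth_act_hexad.
by apply/eqP/eqP => [->//|]; apply: hexad_inj.
Qed.

(** Every r-element is conjugate into the explicit Sylow subgroup, where fixed points were counted.
    For odd r that subgroup has exponent dividing r, so it contains no conjugate of an element of
    order r^2. *)
Lemma sylow_facts r k a b ws : prime r -> sylow_check r k a b ws ->
    logn r M22_order = k ->
  [/\ forall g : gT, #[g]%g = r -> #|[pred i | act_point g i == i]| = a,
      forall g : gT, #[g]%g = r -> #|[pred i | act_hexad g i == i]| = b
    & odd r -> forall g : gT, ~~ (r ^ 2 %| #[g]%g)%N].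
Proof.
move=> pr_r /(sylow_checkP pr_r)[P [P_M22 cardP fixP expP]] log_r.
pose Q := (f @*^-1 P)%G.
have fQ : (f @* Q)%g = P by rewrite morphpreK ?im_f.
have cardQ : #|Q| = #|P| by rewrite -fQ card_injm ?subsetT.
have sylQ : (r.-Sylow([set: gT]) Q)%g.
  by rewrite pHallE subsetT cardsT card_M22 p_part log_r -cardP -cardQ eqxx.
have conjP (g : gT) : (r.-elt g)%g -> exists x, f (g ^ x)%g \in P.
  move=> r_g; have [x _] := Sylow_Jsub sylQ (subsetT <[g]>%g) r_g.
  by rewrite -cycleJ cycle_subG => /morphpreP[_ Px]; exists x.
have fix_r (g : gT) : #[g]%g = r ->
    #|[pred i | act_point g i == i]| = a /\ #|[pred i | act_hexad g i == i]| = b.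
  move=> og; have [|x Px] := conjP g; first by rewrite /p_elt og pnat_id.
  rewrite -(fixed_points_conj g x act_point1 act_pointM).
  rewrite -(fixed_points_conj g x act_hexad1 act_hexadM).
  rewrite fix_pointE fix_hexadE; apply: fixP.
    by rewrite morphV ?inE // groupV.
  by rewrite f_order orderV orderJ.
split=> [g /fix_r[]//|g /fix_r[]//|odd_r g]; apply/negP => /dvdnP[c oc].
have c_gt0 : 0 < c by move: (order_gt0 g); rewrite oc muln_gt0 => /andP[].
have oy : #[g ^+ c]%g = (r ^ 2)%N.
  by rewrite orderXdiv oc ?dvdn_mulr // mulKn.
have [|x Px] := conjP (g ^+ c)%g; first by rewrite /p_elt oy pnatX pnat_id.
have := expP odd_r _ Px; rewrite -morphX ?inE // => /eqP.
rewrite morph_injm_eq1 ?inE // -conjXg conjg_eq1 -order_dvdn oy.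
by rewrite -{2}[r]expn1 dvdn_Pexp2l // prime_gt1.
Qed.

End M22Facts.

(** * Refuting the missing orders *)

Lemma M22_order_gt0 : 0 < M22_order.
Proof. by rewrite !muln_gt0. Qed.

Lemma logn_M22_order r : prime r ->
  logn r M22_order = 7 * (r == 2) + (2 * (r == 3) + ((r == 5) + ((r == 7) + (r == 11)))).
Proof.
move=> pr_r; rewrite /M22_order lognM // lognX lognM // lognX lognM // lognM //.
by rewrite !logn_prime // !(eq_sym r).
Qed.

Lemma prime_dvdn_M22_order r : prime r -> r %| M22_order -> r \in [:: 2; 3; 5; 7; 11].
Proof.
move=> pr_r r_M; have : 0 < logn r M22_order by rewrite logn_gt0 mem_primes pr_r M22_order_gt0.
by rewrite logn_M22_order // !inE; do 5 case: eqP => //.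
Qed.


Section NoUnit.

Variables (gT : finGroupType) (f : {morphism [set: gT] >-> {perm 'I_22}}).
Hypotheses (inj_f : ('injm f)%g) (im_f : (f @* [set: gT])%g = M22).
Variables (p q : nat) (u : group_ring int gT).
Hypotheses (aug_u : augmentation u = 1%R) (ord_u : has_order u (p * q)).
Hypothesis no_pq : forall g : gT, #[g]%g != p * q.

Let F2 := sylow_facts inj_f im_f (isT : prime 2) sylow_check2 (@logn_M22_order 2 isT).
Let F3 := sylow_facts inj_f im_f (isT : prime 3) sylow_check3 (@logn_M22_order 3 isT).
Let F5 := sylow_facts inj_f im_f (isT : prime 5) sylow_check5 (@logn_M22_order 5 isT).
Let F7 := sylow_facts inj_f im_f (isT : prime 7) sylow_check7 (@logn_M22_order 7 isT).
Let F11 := sylow_facts inj_f im_f (isT : prime 11) sylow_check11 (@logn_M22_order 11 isT).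

Let no_sq r (g : gT) : r \in [:: 2; 3; 5; 7; 11] -> odd r -> ~~ (r ^ 2 %| #[g]%g).
Proof.
rewrite !inE => /or4P[|||/orP[]] /eqP-> // odd_r.
- by case: F3 => _ _; apply.
- by case: F5 => _ _; apply.
- by case: F7 => _ _; apply.
by case: F11 => _ _; apply.
Qed.

Lemma no_unit_order : p \in [:: 2; 3; 5; 7; 11] -> q \in [:: 2; 3; 5; 7; 11] ->
  p < q -> (p, q) != (2, 3) -> False.
Proof.
move=> p_in q_in lt_pq n23.
have pr x : x \in [:: 2; 3; 5; 7; 11] -> prime x 
  by apply: (@allP _ prime [:: 2; 3; 5; 7; 11]).
have ne_pq : p != q by rewrite neq_ltn lt_pq.
have no_r2 r (g : gT) : (r == p) || (r == q) -> odd r -> ~~ (r ^ 2 %| #[g]%g).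
  by case/orP => /eqP->; apply: no_sq.
have mp := unit_pq_multiplicities (act_point1 f) (act_pointM f) (pr p p_in) (pr q q_in)
  ne_pq no_pq no_r2 _ _ aug_u ord_u.
have mh := unit_pq_multiplicities (act_hexad1 im_f) (act_hexadM im_f)
  (pr p p_in) (pr q q_in) ne_pq no_pq no_r2 _ _ aug_u ord_u.
rewrite !card_ord in mp mh.
case: F2 F3 F5 F7 F11 => [P2 H2 _] [P3 H3 _] [P5 H5 _] [P7 H7 _] [P11 H11 _].
move: p_in q_in lt_pq n23 mp mh {no_r2 ne_pq pr}; rewrite !inE.
move=> /or4P[|||/orP[]] /eqP-> /or4P[|||/orP[]] /eqP-> //= _ _ mp mh.
(* On hexads with p q = 10, the multiplicities require -24 <= t <= 18 and t = 8 modulo 10, while t =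
   2 + 11 c leaves only -20, -9, 2 and 13. The other pairs are refuted by similar arithmetic, on
   points ([mp]) or hexads ([mh]). *)
- by have [c [k []]] := mh _ _ H2 H5; lia.
- by have [c [k []]] := mh _ _ H2 H7; lia.
- by have [c [k []]] := mp _ _ P2 P11; lia.
- by have [c [k []]] := mp _ _ P3 P5; lia.
- by have [c [k []]] := mh _ _ H3 H7; lia.
- by have [c [k []]] := mp _ _ P3 P11; lia.
- by have [c [k []]] := mp _ _ P5 P7; lia.
- by have [c [k []]] := mp _ _ P5 P11; lia.
- by have [c [k []]] := mp _ _ P7 P11; lia.
Qed.

End NoUnit.

Lemma M22_order6 : exists2 s, s \in M22 & #[s]%g = 6.
Proof.
exists (word_perm [:: 0; 2]); first exact: word_perm_in.
set s := word_perm _.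
have powE i : (s ^+ i == 1)%g = (lpow (word_list [:: 0; 2]) i == iota 0 22).
  by rewrite -(inj_eq code_inj) codeX code1 code_word.
have : #[s]%g %| 6 by rewrite order_dvdn powE; vm_compute.
have ndvd i : ~~ (lpow (word_list [:: 0; 2]) i == iota 0 22) -> ~~ (#[s]%g %| i).
  by rewrite order_dvdn powE.
have n2 : ~~ (#[s]%g %| 2) by apply: ndvd; vm_compute.
have n3 : ~~ (#[s]%g %| 3) by apply: ndvd; vm_compute.
rewrite dvdn_divisors // [divisors 6](_ : _ = [:: 1; 2; 3; 6]); last by vm_compute.
rewrite !inE => /or4P[] /eqP os //; by rewrite os in n2 n3.
Qed.

Theorem corollary1 (gT : finGroupType) (isoM22 : [set: gT] \isog M22) :
  eq_graph (prime_graph gT) (prime_graph_V gT).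
Proof.
have [f inj_f im_f] := isogP isoM22.
have vertexE p : vertex (prime_graph gT) p <-> vertex (prime_graph_V gT) p.
  split=> -[pr_p] /= => [p_G|[u [[_ aug_u] ord_u]]]; split=> //.
    have [|g _ og] := @Cauchy gT p [set: gT] pr_p; first by rewrite cardsT.
    exists (group_elt g); split; first exact: group_elt_normalized.
    by rewrite -og; apply: group_elt_order.
  exact: prime_order_unit_dvdn ord_u aug_u.
split=> // p q; split=> -[/vertexE Vp /vertexE Vq ne_pq].
  case=> g og; split=> //; exists (group_elt g).
  by split; [apply: group_elt_normalized | rewrite -og; apply: group_elt_order].
case=> u [[_ aug_u] ord_u]; split=> //.
(* Either G provides the edge, or the hypothesis [no_pq] of the Luthar-Passi argument holds; in that
   case [M22_order6] excludes p q = 6. *)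
have [/existsP[g /eqP og]|/existsPn no_pq] := boolP [exists g : gT, #[g]%g == p * q].
  by exists g.
have order6 : p * q != 6.
  have [s sM os] := M22_order6; apply: contraTneq isT => pq6.
  have /morphimP[g _ _ sE] : s \in (f @* [set: gT])%g by rewrite im_f.
  by case/negP: (no_pq g); rewrite pq6 -(order_injm inj_f) ?inE // -sE os.
have in_primes r : vertex (prime_graph gT) r -> r \in [:: 2; 3; 5; 7; 11].
  by case=> pr_r r_G; apply: prime_dvdn_M22_order; rewrite // -(card_M22 inj_f im_f).
have in_p := in_primes p Vp; have in_q := in_primes q Vq.
case: (ltngtP p q) => [lt_pq|lt_qp|//].
  case: (no_unit_order inj_f im_f aug_u ord_u no_pq in_p in_q lt_pq).
  by apply: contra order6 => /eqP[-> ->].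
rewrite mulnC in ord_u order6.
have no_qp (g : gT) : #[g]%g != q * p by rewrite mulnC.
case: (no_unit_order inj_f im_f aug_u ord_u no_qp in_q in_p lt_qp).
by apply: contra order6 => /eqP[-> ->].
Qed.
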